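(* Let $b$ be a complex number with $\mathrm{Re}\,b>\frac12$. Then $$\frac14\sum_{n=1}^\infty\frac{\left(\frac12\right)_n(b)_n}{n!(2b)_n}H_n=\sum_{n=1}^\infty\frac{\left(\frac12\right)_n(1-b)_n}{n!\left(b+\frac12\right)_n}H_{2n}+\frac{\Gamma\left(b+\frac12\right)\Gamma(2b-1)}{\Gamma(b)\Gamma\left(2b-\frac12\right)}\ln 2.$$
   Context: $(x)_n=x(x+1)\cdots(x+n-1)$ is the Pochhammer symbol, $H_n=\sum_{k=1}^n\frac1k$ is the $n$-th harmonic number, and $\Gamma$ is the gamma function. *)

(* Defs.v *)
From Stdlib Require Import Arith Reals.
From Coquelicot Require Import Coquelicot.

Open Scope C_scope.

Definition Cexp (z : C) : C :=
  ((exp (Re z) * cos (Im z))%R, (exp (Re z) * sin (Im z))%R).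

(* Principal value of t ^ z, for real t > 0. *)
Definition Rcpow (t : R) (z : C) : C := Cexp (z * ln t).

(* Euler's integral of t^(z-1) e^(-t) over (0, +oo).  It is the gamma function
   on the half-plane Re z > 0; no analytic continuation is made, so the value
   is meaningless elsewhere. *)
Definition CGamma (z : C) : C :=
  @RInt_gen C_R_CompleteNormedModule
    (fun t : R => Rcpow t (z - 1) * exp (- t))
    (at_right 0) (Rbar_locally p_infty).

Fixpoint pochhammer (x : C) (n : nat) : C :=
  match n with
  | O => 1
  | S m => pochhammer x m * (x + INR m)
  end.

Definition harmonic (n : nat) : R := sum_n_m (fun k : nat => (/ INR k)%R) 1 n.

(* Main.v *)
Require Import Defs.
From Stdlib Require Import Arith Reals Lra Lia Psatz.
From Coquelicot Require Import Coquelicot.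

(** Write F and G for the Gauss hypergeometric functions with parameters
    (1/2, b; 2b) and (1/2, 1-b; b+1/2).  They are linked by the quadratic
    transformation F(t) = (1+z) G(z^2), where t = 4z/(1+z)^2.  Read as an identity
    of power series in t it says that

      c_n = sum_m d_m A(2m, n),   A(k, n) = coefficient of t^n in (1+z) z^k,

    where c_n and d_m are the coefficients of F and G.  The numbers A(k, n)
    ([kernel]) are explicit and nonnegative, they vanish for n < k, and the
    identity ([quadratic_transformation]) is a finite sum that a telescoping
    certificate proves, so neither analytic continuation nor differential
    equations are involved.

    Multiply by the harmonic number H_n and sum over n.  The order of summation
    may be exchanged because A is nonnegative and sum |d_m| H_(2m) converges, so
    everything rests on the single evaluation

      sum_n A(k, n) H_n = 4 (H_k + ln 2)      ([kernel_harmonic_series]),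

    which turns the left-hand series into 4 sum_m d_m (H_(2m) + ln 2).  The
    difference of A in k is four times the difference in n of the probability
    that a simple random walk is at 2k+2 at time 2n ([kernel_S_telescopes]), so
    the evaluation follows by summation by parts and induction on k; ln 2 enters
    at k = 0.

    It remains to know sum_m d_m = G(1), which is Gauss's theorem
    ([gauss_summation]).  Both the sum and the quotient of gamma values satisfy
    the same first-order recurrence in the third parameter c, and both tend to
    the same limit as c is shifted to infinity.  For the gamma quotient this is
    the asymptotics Gamma(z + m) ~ m^z Gamma(m) ([CGamma_asymptotic]), which
    expresses that the gamma density of order m, rescaled by m, concentrates
    at 1. *)

(** * Harmonic numbers and logarithms *)

Lemma harmonic_0 : harmonic 0 = 0.
Proof. unfold harmonic. rewrite sum_n_m_zero; [reflexivity | lia]. Qed.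

Lemma harmonic_S (n : nat) : harmonic (S n) = harmonic n + / INR (S n).
Proof. unfold harmonic. rewrite sum_n_Sm; [reflexivity | lia]. Qed.

Lemma ln_succ_bounds (n : nat) :
  / INR (S (S n)) <= ln (INR (S (S n))) - ln (INR (S n)) <= / INR (S n).
Proof.
  assert (H1 : 0 < INR (S n)) by (apply lt_0_INR; lia).
  assert (H2 : 0 < INR (S (S n))) by (apply lt_0_INR; lia).
  assert (E : INR (S (S n)) = INR (S n) + 1) by (rewrite S_INR; ring).
  assert (Hln : forall x, 0 < x -> ln x <= x - 1).
  { intros x Hx. assert (H := exp_ineq1_le (ln x)). rewrite exp_ln in H; lra. }
  split.
  - replace (ln (INR (S (S n))) - ln (INR (S n))) with (- ln (INR (S n) / INR (S (S n)))).
    2:{ rewrite ln_div by lra. ring. }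
    assert (H := Hln (INR (S n) / INR (S (S n)))).
    assert (0 < INR (S n) / INR (S (S n))) by (apply Rdiv_lt_0_compat; lra).
    replace (/ INR (S (S n))) with (- (INR (S n) / INR (S (S n)) - 1)).
    2:{ rewrite E. field. lra. }
    specialize (H ltac:(lra)). lra.
  - rewrite <- ln_div by lra.
    eapply Rle_trans; [apply Hln; apply Rdiv_lt_0_compat; lra|].
    right. rewrite E. field. lra.
Qed.

Lemma harmonic_bounds (n : nat) :
  ln (INR (S n)) <= harmonic n /\ harmonic (S n) <= 1 + ln (INR (S n)).
Proof.
  induction n as [|n [IH1 IH2]].
  - rewrite harmonic_S, harmonic_0. simpl. rewrite ln_1. lra.
  - rewrite (harmonic_S (S n)). assert (H := ln_succ_bounds n).
    rewrite harmonic_S in *. lra.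
Qed.

Lemma harmonic_ge_0 (n : nat) : 0 <= harmonic n.
Proof.
  destruct (harmonic_bounds n) as [H _]. eapply Rle_trans; [|exact H].
  rewrite <- ln_1. apply ln_le; [lra|]. apply (le_INR 1); lia.
Qed.

Lemma is_lim_seq_ln_INR : is_lim_seq (fun n => ln (INR n)) p_infty.
Proof.
  apply (is_lim_comp_seq ln INR p_infty p_infty).
  - apply is_lim_ln_p.
  - exists O. intros; discriminate.
  - apply is_lim_seq_INR.
Qed.

Lemma is_lim_seq_harmonic : is_lim_seq harmonic p_infty.
Proof.
  apply is_lim_seq_le_p_loc with (fun n => ln (INR (S n))).
  - exists O. intros n _. apply harmonic_bounds.
  - apply (is_lim_seq_incr_1 (fun n => ln (INR n))). apply is_lim_seq_ln_INR.
Qed.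

Lemma is_lim_seq_inv_S : is_lim_seq (fun n => / INR (S n)) 0.
Proof.
  apply (is_lim_seq_incr_1 (fun n => / INR n)).
  apply (is_lim_seq_inv INR p_infty); [apply is_lim_seq_INR | discriminate].
Qed.

Lemma is_series_iff_lim (a : nat -> R) (l : R) :
  is_series a l <-> is_lim_seq (sum_n a) l.
Proof. reflexivity. Qed.

Lemma telescoping_series (u : nat -> R) (l : R) :
  is_lim_seq u l -> is_series (fun n => u n - u (S n)) (u O - l).
Proof.
  intros H. apply is_series_iff_lim.
  apply (is_lim_seq_ext (fun n => u O - u (S n))).
  { intros n. induction n as [|n IH].
    - rewrite sum_O. ring.
    - rewrite sum_Sn, <- IH. unfold plus; simpl. ring. }
  apply (is_lim_seq_minus' (fun _ => u O) (fun n => u (S n))).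
  - apply is_lim_seq_const.
  - apply (is_lim_seq_incr_1 u). exact H.
Qed.

(** Moves the difference from [w] to the harmonic numbers, whose increments are
    the reciprocals; the boundary term is the assumed limit. *)
Lemma harmonic_summation_by_parts (w : nat -> R) (s : R) :
  is_lim_seq (fun n => w n * harmonic n) 0 ->
  is_series (fun n => w (S n) / INR (S n)) s ->
  is_series (fun n => (w n - w (S n)) * harmonic n) s.
Proof.
  intros Hw Hs. apply is_series_iff_lim.
  apply (is_lim_seq_ext
    (fun n => sum_n (fun n => w (S n) / INR (S n)) n - w (S n) * harmonic (S n))).
  { intros n. induction n as [|n IH].
    - rewrite !sum_O, harmonic_S, harmonic_0. simpl. field.
    - rewrite !sum_Sn, <- IH, (harmonic_S (S n)). unfold plus; simpl.
      change (match n with 0%nat => 1 | S _ => INR n + 1 end) with (INR (S n)).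
      unfold Rdiv. ring. }
  replace (Finite s) with (Finite (s - 0)) by (f_equal; ring).
  apply is_lim_seq_minus'.
  - exact Hs.
  - apply (is_lim_seq_incr_1 (fun n => w n * harmonic n)). exact Hw.
Qed.


Lemma is_series_ext_R (a b : nat -> R) (l : R) :
  (forall n, a n = b n) -> is_series a l -> is_series b l.
Proof. intros H. apply is_series_ext. exact H. Qed.

Lemma is_series_scal_eq (c : R) (a : nat -> R) (l l' : R) :
  is_series a l -> c * l = l' -> is_series (fun n => c * a n) l'.
Proof. intros H <-. exact (is_series_scal_l c a l H). Qed.

Lemma is_series_plus_eq (a b : nat -> R) (la lb l : R) :
  is_series a la -> is_series b lb -> la + lb = l -> is_series (fun n => a n + b n) l.
Proof. intros Ha Hb <-. exact (is_series_plus a b la lb Ha Hb). Qed.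

(** * Expansion coefficients of the quadratic substitution *)

(** The probability binom(2n, n-k) / 4^n that a simple random walk is at 2k after
    2n steps.  Extending it by zero beyond k = n makes all the contiguity relations
    below hold without side conditions. *)
Definition walk (k n : nat) : R :=
  if (k <=? n)%nat
  then INR (fact (2 * n)) / (INR (fact (n - k)) * INR (fact (n + k)) * 4 ^ n)
  else 0.

Lemma walk_ge_0 (k n : nat) : 0 <= walk k n.
Proof.
  unfold walk. destruct (k <=? n)%nat; [|lra].
  apply Rlt_le, Rdiv_lt_0_compat; [apply INR_fact_lt_0|].
  repeat apply Rmult_lt_0_compat; try apply INR_fact_lt_0. apply pow_lt; lra.
Qed.

Lemma walk_gt (k n : nat) : (n < k)%nat -> walk k n = 0.
Proof. intros H. unfold walk. destruct (Nat.leb_spec k n); [lia|reflexivity]. Qed.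

Lemma walk_0_0 : walk 0 0 = 1.
Proof. unfold walk. simpl. field. Qed.

(** This relation and the next one determine [walk] from its value at (0, 0), and the
    later contiguity identities follow from them.  They are stated without division
    so that they survive at the border of the support. *)
Lemma walk_S_l (k n : nat) :
  (INR n + INR k + 1) * walk (S k) n = (INR n - INR k) * walk k n.
Proof.
  unfold walk.
  destruct (Nat.leb_spec (S k) n) as [H|H]; destruct (Nat.leb_spec k n) as [H'|H'];
    try lia.
  - replace (n - k)%nat with (S (n - S k)) by lia.
    replace (n + S k)%nat with (S (n + k)) by lia.
    rewrite !fact_simpl, !mult_INR.
    assert (E1 : INR (S (n + k)) = INR n + INR k + 1) by (rewrite S_INR, plus_INR; ring).
    assert (E2 : INR (S (n - S k)) = INR n - INR k).
    { replace (S (n - S k)) with (n - k)%nat by lia. apply minus_INR; lia. }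
    rewrite E1, E2.
    assert (INR k + 1 <= INR n) by (rewrite <- S_INR; apply le_INR; lia).
    pose proof (pos_INR k).
    field. repeat split; try apply INR_fact_neq_0; try (apply pow_nonzero); lra.
  - assert (n = k) by lia. subst. ring.
  - ring.
Qed.

Lemma walk_S_r (k n : nat) :
  (INR n + 1 - INR k) * (INR n + 1 + INR k) * walk k (S n)
  = (INR n + 1) * (INR n + 1 / 2) * walk k n.
Proof.
  unfold walk.
  destruct (Nat.leb_spec k (S n)) as [H|H]; destruct (Nat.leb_spec k n) as [H'|H'];
    try lia.
  - replace (S n - k)%nat with (S (n - k)) by lia.
    replace (S n + k)%nat with (S (n + k)) by lia.
    replace (2 * S n)%nat with (S (S (2 * n))) by lia.
    rewrite (fact_simpl (S (2 * n))), (fact_simpl (2 * n)), (fact_simpl (n - k)),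
      (fact_simpl (n + k)), !mult_INR, !S_INR, plus_INR, minus_INR, mult_INR by lia.
    change (INR 2) with 2. simpl pow.
    assert (INR k <= INR n) by (apply le_INR; lia).
    pose proof (pos_INR k).
    field. repeat split; try apply INR_fact_neq_0; try (apply pow_nonzero); lra.
  - assert (k = S n) by lia. subst. rewrite S_INR. ring.
  - ring.
Qed.

Lemma walk_S_S (k n : nat) :
  (INR n + INR k + 2) * walk (S k) (S n) = (INR n + 1 - INR k) * walk k (S n).
Proof.
  pose proof (walk_S_l k (S n)) as E. rewrite S_INR in E. rewrite <- E. ring.
Qed.

Lemma walk_decreasing_l (k n : nat) : walk (S k) n <= walk k n.
Proof.
  destruct (Nat.lt_ge_cases n (S k)) as [H|H].
  - rewrite walk_gt by assumption. apply walk_ge_0.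
  - pose proof (walk_S_l k n) as E. pose proof (walk_ge_0 (S k) n).
    pose proof (walk_ge_0 k n).
    pose proof (pos_INR k). pose proof (pos_INR n). nra.
Qed.

Lemma walk_le_center (k n : nat) : walk k n <= walk 0 n.
Proof.
  induction k as [|k IH]; [lra|].
  eapply Rle_trans; [apply walk_decreasing_l | exact IH].
Qed.

Lemma walk_0_S (n : nat) :
  (INR n + 1) * walk 0 (S n) = (INR n + 1 / 2) * walk 0 n.
Proof.
  pose proof (walk_S_r 0 n) as E. simpl INR in E. pose proof (pos_INR n).
  apply (Rmult_eq_reg_l (INR n + 1)); lra.
Qed.

(** The left-hand side is decreasing in [n], with ratio
    (2n+1)(2n+3) / (2n+2)^2. *)
Lemma walk_center_bound (n : nat) : walk 0 n ^ 2 * (2 * INR n + 1) <= 1.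
Proof.
  induction n as [|n IH].
  - rewrite walk_0_0. simpl. lra.
  - pose proof (walk_0_S n) as E. pose proof (pos_INR n).
    rewrite S_INR.
    replace (walk 0 (S n)) with ((INR n + 1 / 2) / (INR n + 1) * walk 0 n).
    2:{ apply (Rmult_eq_reg_l (INR n + 1)); [|lra]. rewrite E. field. lra. }
    eapply Rle_trans; [|exact IH].
    replace (((INR n + 1 / 2) / (INR n + 1) * walk 0 n) ^ 2 * (2 * (INR n + 1) + 1))
      with (walk 0 n ^ 2 * ((INR n + 1 / 2) ^ 2 * (2 * INR n + 3) / (INR n + 1) ^ 2))
      by (field; lra).
    apply Rmult_le_compat_l; [apply pow2_ge_0|].
    apply Rle_div_l; [nra|]. nra.
Qed.

Lemma is_lim_walk_harmonic (k : nat) : is_lim_seq (fun n => walk k n * harmonic n) 0.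
Proof.
  apply is_lim_seq_incr_1.
  (* With y the fourth root of n+1, the harmonic number is at most 1 + ln (y^4) <= 5 y,
     while the central probability is at most 1 / y^2. *)
  set (q := fun n => / sqrt (sqrt (INR (S n)))).
  apply (is_lim_seq_le_le (fun _ => 0) _ (fun n => 5 * q n)).
  - intros n. split.
    + apply Rmult_le_pos; [apply walk_ge_0 | apply harmonic_ge_0].
    + assert (HS : 1 <= INR (S n)) by (apply (le_INR 1); lia).
      assert (H1 : 1 <= sqrt (INR (S n))).
      { rewrite <- sqrt_1. apply sqrt_le_1; lra. }
      assert (H2 : 1 <= sqrt (sqrt (INR (S n)))).
      { rewrite <- sqrt_1. apply sqrt_le_1; lra. }
      set (y := sqrt (sqrt (INR (S n)))) in *.
      assert (Ey : y * y = sqrt (INR (S n))) by (apply sqrt_sqrt; lra).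
      assert (Ey4 : INR (S n) = (y * y) * (y * y)).
      { rewrite Ey. symmetry. apply sqrt_sqrt; lra. }
      assert (HL : harmonic (S n) <= 5 * y).
      { destruct (harmonic_bounds n) as [_ H]. rewrite Ey4 in H.
        rewrite !ln_mult in H by nra.
        assert (ln y <= y) .
        { assert (Hy := exp_ineq1_le (ln y)). rewrite exp_ln in Hy; lra. }
        lra. }
      assert (HW : walk k (S n) <= / (y * y)).
      { eapply Rle_trans; [apply walk_le_center|].
        pose proof (walk_center_bound (S n)) as Hc. rewrite Ey4 in Hc.
        pose proof (walk_ge_0 0 (S n)) as Hp.
        apply Rsqr_incr_0_var; [|left; apply Rinv_0_lt_compat; nra].
        unfold Rsqr. replace (/ (y * y) * / (y * y)) with (1 / (y * y * (y * y))) by (field; lra).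
        assert (HY : 0 < y * y * (y * y)) by (repeat apply Rmult_lt_0_compat; lra).
        apply (proj1 (Rle_div_r _ _ _ HY)).
        set (Y := y * y * (y * y)) in *. set (W := walk 0 (S n)) in *.
        pose proof (Rmult_le_pos _ _ (pow2_ge_0 W) (Rlt_le _ _ HY)). nra. }
      fold (q n) in *. unfold q. fold y.
      replace (5 * / y) with (/ (y * y) * (5 * y)) by (field; lra).
      apply Rmult_le_compat; auto using walk_ge_0, harmonic_ge_0.
  - apply is_lim_seq_const.
  - replace (Finite 0) with (Rbar_mult 5 0) by (simpl; f_equal; ring).
    apply is_lim_seq_scal_l. unfold q.
    apply (is_lim_seq_inv (fun n => sqrt (sqrt (INR (S n)))) p_infty); [|discriminate].
    apply (filterlim_comp _ _ _ (fun n => sqrt (INR (S n))) sqrt _ (Rbar_locally p_infty)).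
    2:{ apply filterlim_sqrt_p. }
    apply (filterlim_comp _ _ _ (fun n => INR (S n)) sqrt _ (Rbar_locally p_infty)).
    2:{ apply filterlim_sqrt_p. }
    apply (is_lim_seq_incr_1 INR), is_lim_seq_INR.
Qed.

Lemma is_lim_walk (k : nat) : is_lim_seq (walk k) 0.
Proof.
  apply is_lim_seq_incr_1.
  apply (is_lim_seq_le_le (fun _ => 0) _ (fun n => walk k (S n) * harmonic (S n))).
  - intros n. split; [apply walk_ge_0|].
    rewrite <- (Rmult_1_r (walk k (S n))) at 1.
    apply Rmult_le_compat_l; [apply walk_ge_0|].
    induction n as [|n IH]; rewrite harmonic_S.
    + rewrite harmonic_0. simpl. lra.
    + assert (0 < / INR (S (S n))) by (apply Rinv_0_lt_compat, lt_0_INR; lia). lra.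
  - apply is_lim_seq_const.
  - apply (is_lim_seq_incr_1 (fun n => walk k n * harmonic n)), is_lim_walk_harmonic.
Qed.

(** The coefficient of t^n in (1+z) z^k, where t = 4z/(1+z)^2. *)
Definition kernel (k n : nat) : R := (2 * INR k + 1) / (INR n + INR k + 1) * walk k n.

Lemma kernel_ge_0 (k n : nat) : 0 <= kernel k n.
Proof.
  unfold kernel. pose proof (pos_INR k). pose proof (pos_INR n).
  apply Rmult_le_pos; [|apply walk_ge_0].
  apply Rlt_le, Rdiv_lt_0_compat; lra.
Qed.

Lemma kernel_0_telescopes (n : nat) : kernel 0 n = 2 * (walk 0 n - walk 0 (S n)).
Proof.
  unfold kernel. pose proof (pos_INR n). pose proof (walk_0_S n) as E.
  simpl INR. replace (walk 0 (S n)) with ((INR n + 1 / 2) / (INR n + 1) * walk 0 n).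
  - field. lra.
  - apply (Rmult_eq_reg_l (INR n + 1)); [|lra]. rewrite E. field. lra.
Qed.

(** In terms of generating functions, (1+z)(z^(k+1) - z^k) is a multiple of
    (1-t) d(z^(k+1))/dt, and multiplication by 1-t takes differences of
    coefficients. *)
Lemma kernel_S_telescopes (k n : nat) :
  kernel (S k) n - kernel k n = 4 * (walk (S k) n - walk (S k) (S n)).
Proof.
  unfold kernel. pose proof (pos_INR n). pose proof (pos_INR k).
  pose proof (walk_S_l k n) as E1. pose proof (walk_S_r k n) as E2.
  pose proof (walk_S_S k n) as E3.
  replace (walk (S k) (S n)) with ((INR n + 1 - INR k) / (INR n + INR k + 2) * walk k (S n)).
  2:{ apply (Rmult_eq_reg_l (INR n + INR k + 2)); [|lra]. rewrite E3. field. lra. }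
  replace (walk (S k) n) with ((INR n - INR k) / (INR n + INR k + 1) * walk k n).
  2:{ apply (Rmult_eq_reg_l (INR n + INR k + 1)); [|lra]. rewrite E1. field. lra. }
  replace (walk k n) with
    ((INR n + 1 - INR k) * (INR n + 1 + INR k) / ((INR n + 1) * (INR n + 1 / 2)) * walk k (S n)).
  2:{ apply (Rmult_eq_reg_l ((INR n + 1) * (INR n + 1 / 2))); [|nra]. rewrite <- E2. field. lra. }
  rewrite S_INR. field. lra.
Qed.

(** * Sums of the coefficients against harmonic numbers *)

(** At t = 1 one has z = 1, where (1+z) z^k equals 2. *)
Lemma kernel_series (k : nat) : is_series (kernel k) 2.
Proof.
  induction k as [|k IH].
  - apply (is_series_ext_R (fun n => 2 * (walk 0 n - walk 0 (S n)))).
    { intros n. symmetry. apply kernel_0_telescopes. }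
    eapply is_series_scal_eq; [apply telescoping_series, is_lim_walk|].
    rewrite walk_0_0. ring.
  - apply (is_series_ext_R (fun n => kernel k n + 4 * (walk (S k) n - walk (S k) (S n)))).
    { intros n. rewrite <- kernel_S_telescopes. ring. }
    eapply is_series_plus_eq; [exact IH| |].
    + eapply is_series_scal_eq; [apply telescoping_series, is_lim_walk | reflexivity].
    + rewrite walk_gt by lia. ring.
Qed.

(** The quantity k * walk k n / n is the probability that the walk reaches 2k
    for the first time at time 2n, that is, the coefficient of t^n in z^k; the
    identity splits (1+z) z^k into its two powers of z. *)
Lemma kernel_passage (k n : nat) :
  kernel k (S n)
  = INR k * (walk k (S n) / INR (S n)) + INR (S k) * (walk (S k) (S n) / INR (S n)).
Proof.
  unfold kernel. pose proof (pos_INR n). pose proof (pos_INR k).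
  pose proof (walk_S_S k n) as E.
  replace (walk (S k) (S n)) with ((INR n + 1 - INR k) / (INR n + INR k + 2) * walk k (S n)).
  2:{ apply (Rmult_eq_reg_l (INR n + INR k + 2)); [|lra]. rewrite E. field. lra. }
  rewrite !S_INR. field. lra.
Qed.

Lemma kernel_0_r (k : nat) : kernel k 0 = match k with O => 1 | S _ => 0 end.
Proof.
  unfold kernel. destruct k.
  - rewrite walk_0_0. simpl. field.
  - rewrite walk_gt by lia. ring.
Qed.

Lemma kernel_series_S (k : nat) :
  is_series (fun n => kernel k (S n)) (match k with O => 1 | S _ => 2 end).
Proof.
  apply (is_series_incr_1 (kernel k)).
  replace (plus _ _) with 2; [apply kernel_series|].
  rewrite kernel_0_r. unfold plus; simpl. destruct k; ring.
Qed.

(** The walk reaches 2k+2 almost surely: the passage probabilities add up to 1. The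
    previous lemma gives the totals for k and k+1 together, so one proceeds by
    induction. *)
Lemma walk_passage_series (k : nat) :
  is_series (fun n => walk (S k) (S n) / INR (S n)) (/ INR (S k)).
Proof.
  assert (Hk : INR (S k) <> 0) by (apply not_0_INR; lia).
  assert (H : is_series (fun n => INR (S k) * (walk (S k) (S n) / INR (S n))) 1).
  { clear Hk. induction k as [|k IH].
    - refine (is_series_ext_R _ _ _ _ (kernel_series_S 0)).
      intros n. rewrite kernel_passage. simpl INR at 1. ring.
    - apply (is_series_ext_R (fun n => kernel (S k) (S n)
               - INR (S k) * (walk (S k) (S n) / INR (S n)))).
      + intros n. rewrite kernel_passage. ring.
      + replace 1 with (2 - 1) by ring.
        exact (is_series_minus _ _ _ _ (kernel_series_S (S k)) IH). }
  refine (is_series_ext_R _ _ _ _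
            (is_series_scal_eq (/ INR (S k)) _ _ (/ INR (S k)) H (Rmult_1_r _))).
  intros n. field. split; apply not_0_INR; lia.
Qed.

(** The number binom(2n+1, n-j) / 4^(n+1).  Pascal's rule splits [walk] into two
    consecutive values of it, which turns the sum at the centre into an alternating
    sum of reciprocals. *)
Definition half_step (j n : nat) : R :=
  (INR (S n) + INR (S j)) / (2 * INR (S n)) * walk (S j) (S n).

Lemma half_step_bounds (j n : nat) : 0 <= half_step j n <= walk (S j) (S n).
Proof.
  unfold half_step. pose proof (walk_ge_0 (S j) (S n)) as Hp.
  assert (0 < INR (S n)) by (apply lt_0_INR; lia).
  assert (0 < INR (S j)) by (apply lt_0_INR; lia).
  destruct (Nat.lt_ge_cases (S n) (S j)) as [H'|H'].
  - rewrite walk_gt by assumption. lra.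
  - apply le_INR in H'. split.
    + apply Rmult_le_pos; [|exact Hp]. apply Rlt_le, Rdiv_lt_0_compat; lra.
    + rewrite <- (Rmult_1_l (walk (S j) (S n))) at 2.
      apply Rmult_le_compat_r; [exact Hp|]. apply Rle_div_l; lra.
Qed.

Lemma half_step_split (j n : nat) :
  walk (S j) (S n) = half_step j n + half_step (S j) n.
Proof.
  unfold half_step. pose proof (walk_S_S (S j) n) as E.
  pose proof (pos_INR n). pose proof (pos_INR j).
  replace (walk (S (S j)) (S n))
    with ((INR n - INR j) / (INR n + INR j + 3) * walk (S j) (S n)).
  2:{ apply (Rmult_eq_reg_l (INR n + INR j + 3)); [|lra].
      rewrite S_INR in E.
      replace (INR n + (INR j + 1) + 2) with (INR n + INR j + 3) in E by ring.
      rewrite E. field. lra. }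
  rewrite !S_INR. field. lra.
Qed.

Lemma half_step_center (n : nat) : walk 0 (S n) = 2 * half_step 0 n.
Proof.
  unfold half_step. pose proof (walk_S_S 0 n) as E. simpl INR in E.
  pose proof (pos_INR n).
  replace (walk 0 (S n)) with ((INR n + 2) / (INR n + 1) * walk 1 (S n)).
  2:{ apply (Rmult_eq_reg_l (INR n + 1)); [|lra].
      replace ((INR n + 1) * walk 0 (S n)) with ((INR n + 0 + 2) * walk 1 (S n)) by (rewrite E; ring).
      field. lra. }
  rewrite !S_INR. simpl INR. field. lra.
Qed.

Lemma half_step_ex_series (j : nat) : ex_series (fun n => half_step j n / INR (S n)).
Proof.
  apply (@ex_series_le R_AbsRing R_CompleteNormedModule _
           (fun n => walk (S j) (S n) / INR (S n))).
  - intros n. destruct (half_step_bounds j n).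
    assert (0 < / INR (S n)) by (apply Rinv_0_lt_compat, lt_0_INR; lia).
    change (Rabs (half_step j n / INR (S n)) <= walk (S j) (S n) / INR (S n)).
    unfold Rdiv. rewrite Rabs_pos_eq by (apply Rmult_le_pos; lra).
    apply Rmult_le_compat_r; lra.
  - eexists. apply walk_passage_series.
Qed.

Definition half_step_sum (j : nat) : R := Series (fun n => half_step j n / INR (S n)).

Lemma half_step_sum_rec (j : nat) :
  half_step_sum j + half_step_sum (S j) = / INR (S j).
Proof.
  unfold half_step_sum. rewrite <- Series_plus by apply half_step_ex_series.
  rewrite <- (is_series_unique _ _ (walk_passage_series j)).
  apply Series_ext. intros n. rewrite (half_step_split j n). unfold Rdiv. ring.
Qed.

Lemma half_step_sum_bounds (j : nat) : 0 <= half_step_sum j <= / INR (S j).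
Proof.
  assert (Hp : forall j, 0 <= half_step_sum j).
  { intros i. unfold half_step_sum.
    replace 0 with (Series (fun _ : nat => 0)).
    2:{ apply is_series_unique. apply is_series_iff_lim.
        apply (is_lim_seq_ext (fun _ => 0)); [|apply is_lim_seq_const].
        intros n. induction n; [now rewrite sum_O|].
        rewrite sum_Sn, <- IHn. unfold plus; simpl. ring. }
    apply Series_le; [|apply half_step_ex_series].
    intros n. split; [lra|]. apply Rmult_le_pos; [apply half_step_bounds|].
    apply Rlt_le, Rinv_0_lt_compat, lt_0_INR; lia. }
  pose proof (half_step_sum_rec j). pose proof (Hp j). pose proof (Hp (S j)). lra.
Qed.

(** Unrolling [half_step_sum_rec] 2K times gives
    1 - 1/2 + 1/3 - ... - 1/(2K), which is the displayed difference of harmonic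
    numbers. *)
Lemma half_step_sum_harmonic (K : nat) :
  half_step_sum 0 = harmonic (2 * K) - harmonic K + half_step_sum (2 * K).
Proof.
  induction K as [|K IH].
  - simpl. lra.
  - replace (2 * S K)%nat with (S (S (2 * K))) by lia.
    rewrite !harmonic_S, IH.
    pose proof (half_step_sum_rec (2 * K)) as E1.
    pose proof (half_step_sum_rec (S (2 * K))) as E2.
    assert (E : / INR (S K) = 2 * / INR (S (S (2 * K)))).
    { rewrite !S_INR, mult_INR. change (INR 2) with 2. pose proof (pos_INR K).
      field. lra. }
    lra.
Qed.

Lemma harmonic_double_diff (K : nat) :
  ln (INR (S (2 * K))) - ln (INR (S K)) <= harmonic (2 * K) - harmonic K
  /\ harmonic (S (2 * K)) - harmonic (S K) <= ln (INR (S (2 * K))) - ln (INR (S K)).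
Proof.
  assert (H : forall i, ln (INR (S (K + i))) - ln (INR (S K)) <= harmonic (K + i) - harmonic K
    /\ harmonic (S (K + i)) - harmonic (S K) <= ln (INR (S (K + i))) - ln (INR (S K))).
  { induction i as [|i [IH1 IH2]].
    - rewrite Nat.add_0_r. lra.
    - rewrite Nat.add_succ_r. pose proof (ln_succ_bounds (K + i)).
      rewrite (harmonic_S (S (K + i))). rewrite (harmonic_S (K + i)) in *. lra. }
  replace (2 * K)%nat with (K + K)%nat by lia. apply H.
Qed.

(** The difference of harmonic numbers tends to ln 2 and the remainder to 0, both at
    rate 1/K. *)
Lemma half_step_sum_0 : half_step_sum 0 = ln 2.
Proof.
  assert (HK : forall K, Rabs (half_step_sum 0 - ln 2) <= 3 * / INR (S K)).
  { intros K. rewrite (half_step_sum_harmonic K).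
    pose proof (half_step_sum_bounds (2 * K)) as Hb.
    destruct (harmonic_double_diff K) as [H1 H2].
    rewrite !harmonic_S in H2.
    assert (P1 : 0 < INR (S K)) by (apply lt_0_INR; lia).
    assert (P2 : 0 < INR (S (2 * K))) by (apply lt_0_INR; lia).
    assert (I2 : / INR (S (2 * K)) <= / INR (S K)).
    { apply Rinv_le_contravar; [exact P1|]. apply le_INR; lia. }
    pose proof (ln_succ_bounds (2 * K)) as [_ H3].
    assert (E : ln (INR (S (S (2 * K)))) = ln 2 + ln (INR (S K))).
    { rewrite <- ln_mult by lra. f_equal. rewrite !S_INR, mult_INR.
      change (INR 2) with 2. ring. }
    assert (H4 : ln (INR (S (2 * K))) <= ln (INR (S (S (2 * K))))).
    { apply ln_le; [exact P2|]. apply le_INR; lia. }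
    assert (0 < / INR (S (2 * K))) by (apply Rinv_0_lt_compat; exact P2).
    apply Rabs_le. lra. }
  apply Rminus_diag_uniq.
  assert (HL : Rbar_le (Rabs (half_step_sum 0 - ln 2)) 0).
  { apply (is_lim_seq_le (fun _ => Rabs (half_step_sum 0 - ln 2)) (fun K => 3 * / INR (S K))).
    - exact HK.
    - apply is_lim_seq_const.
    - replace (Finite 0) with (Rbar_mult 3 0) by (simpl; f_equal; ring).
      apply is_lim_seq_scal_l, is_lim_seq_inv_S. }
  simpl in HL. pose proof (Rabs_pos (half_step_sum 0 - ln 2)).
  destruct (Req_dec (half_step_sum 0 - ln 2) 0) as [|Hn]; [assumption|].
  apply Rabs_pos_lt in Hn. lra.
Qed.

(** This is where ln 2 enters: the case k = 0 of the evaluation below. *)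
Lemma walk_center_series : is_series (fun n => walk 0 (S n) / INR (S n)) (2 * ln 2).
Proof.
  rewrite <- half_step_sum_0.
  apply (is_series_ext_R (fun n => 2 * (half_step 0 n / INR (S n)))).
  { intros n. rewrite half_step_center. unfold Rdiv. ring. }
  eapply is_series_scal_eq; [apply Series_correct, half_step_ex_series | reflexivity].
Qed.

(** Summation by parts turns the difference of two consecutive values of [k] into
    four times the series of [walk_passage_series], that is, into
    4 / (k+1). *)
Lemma kernel_harmonic_series (k : nat) :
  is_series (fun n => kernel k n * harmonic n) (4 * (harmonic k + ln 2)).
Proof.
  induction k as [|k IH].
  - apply (is_series_ext_R (fun n => 2 * ((walk 0 n - walk 0 (S n)) * harmonic n))).
    { intros n. rewrite kernel_0_telescopes. ring. }
    eapply is_series_scal_eq.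
    + apply harmonic_summation_by_parts; [apply is_lim_walk_harmonic | apply walk_center_series].
    + rewrite harmonic_0. ring.
  - apply (is_series_ext_R (fun n => kernel k n * harmonic n
             + 4 * ((walk (S k) n - walk (S k) (S n)) * harmonic n))).
    { intros n. replace (kernel (S k) n) with
        (kernel k n + 4 * (walk (S k) n - walk (S k) (S n)))
        by (rewrite <- kernel_S_telescopes; ring).
      ring. }
    eapply is_series_plus_eq; [exact IH| |].
    + eapply is_series_scal_eq; [|reflexivity].
      apply harmonic_summation_by_parts; [apply is_lim_walk_harmonic | apply walk_passage_series].
    + rewrite harmonic_S. ring.
Qed.

Lemma harmonic_double_le (m : nat) : (harmonic (2 * m) <= harmonic m + 1)%R.
Proof.
  destruct m as [|m].
  - simpl. lra.
  - destruct (harmonic_bounds (S (2 * m))) as [_ H1].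
    destruct (harmonic_double_diff (S m)) as [_ H].
    pose proof (half_step_sum_harmonic (S m)) as E.
    destruct (half_step_sum_bounds 0) as [_ HW]. destruct (half_step_sum_bounds (2 * S m)) as [HW' _].
    simpl INR in HW. rewrite Rinv_1 in HW. lra.
Qed.

Lemma sum_n_le_total (a : nat -> R) (l : R) (p : nat) :
  (forall n, 0 <= a n)%R -> is_series a l -> (0 <= sum_n a p <= l)%R.
Proof.
  intros Ha Hl. split.
  - induction p as [|p IH]; [rewrite sum_O; apply Ha|].
    rewrite sum_Sn. unfold plus; simpl. specialize (Ha (S p)). lra.
  - apply (is_lim_seq_incr_compare (sum_n a) l Hl).
    intros n. rewrite sum_Sn. unfold plus; simpl. specialize (Ha (S n)). lra.
Qed.

Open Scope C_scope.

(** * Hypergeometric terms and the quadratic transformation *)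

Definition hyper (a b c : C) (n : nat) : C :=
  pochhammer a n * pochhammer b n / (INR (fact n) * pochhammer c n).

Lemma C_neq_0_of_Re (z : C) : (0 < Re z)%R -> z <> 0.
Proof. intros H E. rewrite E in H. simpl in H. lra. Qed.

Lemma shift_neq_0 (c : C) (n : nat) : (0 < Re c)%R -> c + INR n <> 0.
Proof.
  intros H. apply C_neq_0_of_Re. pose proof (pos_INR n).
  unfold Re in *. simpl. lra.
Qed.

Lemma pochhammer_neq_0 (c : C) (n : nat) : (0 < Re c)%R -> pochhammer c n <> 0.
Proof.
  intros H. induction n as [|n IH]; simpl.
  - intros E. apply (f_equal fst) in E. simpl in E. lra.
  - apply Cmult_neq_0; [exact IH | apply shift_neq_0; exact H].
Qed.

Lemma INR_C_neq_0 (n : nat) : (0 < n)%nat -> RtoC (INR n) <> 0.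
Proof. intros H E. apply RtoC_inj in E. apply lt_0_INR in H. lra. Qed.

Lemma RtoC_INR_S (n : nat) : RtoC (INR (S n)) = INR n + 1.
Proof. rewrite S_INR, RtoC_plus. reflexivity. Qed.

Lemma hyper_0 (a b c : C) : hyper a b c 0 = 1.
Proof. unfold hyper. simpl. field. Qed.

Lemma hyper_S (a b c : C) (n : nat) : (0 < Re c)%R ->
  hyper a b c (S n) = (a + INR n) * (b + INR n) / ((INR n + 1) * (c + INR n)) * hyper a b c n.
Proof.
  intros Hc. unfold hyper. rewrite fact_simpl, mult_INR, RtoC_mult, RtoC_INR_S. simpl pochhammer.
  field. repeat split.
  all: first [ apply shift_neq_0; exact Hc | apply pochhammer_neq_0; exact Hc
    | apply INR_C_neq_0, lt_O_fact | rewrite <- RtoC_INR_S; apply INR_C_neq_0; lia ].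
Qed.

(** The coefficients of the transformed function 2F1(1/2, 1-b; b+1/2; x). *)
Local Notation transformed b := (hyper (1 / 2) (1 - b) (b + 1 / 2)).

Definition expansion_term (b : C) (n m : nat) : C :=
  transformed b m * kernel (2 * m) n.

(** Found from the requirement that it vanish at m = 0 and that its first difference
    reproduce the recurrence in [n] satisfied by the coefficients of
    2F1(1/2, b; 2b; x). *)
Definition wz_certificate (b : C) (n m : nat) : C :=
  -2 * INR m * (b - 1 / 2 + INR m) * transformed b m
  * (walk (2 * m) (S n) * (INR n + 2 * INR m + 1) / (INR n + 1))%R.

Lemma Re_plus_half (b : C) : Re (b + 1 / 2) = (Re b + 1 / 2)%R.
Proof. unfold Re; simpl. field. Qed.

Lemma C_neq_0_R (x : R) : x <> 0%R -> RtoC x <> 0.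
Proof. intros H E. apply RtoC_inj in E. contradiction. Qed.

Lemma wz_step (b : C) (n m : nat) : (0 < Re b)%R ->
  (INR n + 1) * (2 * b + INR n) * expansion_term b (S n) m
  - (INR n + 1 / 2) * (b + INR n) * expansion_term b n m
  = wz_certificate b n (S m) - wz_certificate b n m.
Proof.
  intros Hb. unfold expansion_term, wz_certificate.
  assert (Hc : (0 < Re (b + 1 / 2))%R) by (rewrite Re_plus_half; lra).
  rewrite (hyper_S _ _ _ _ Hc).
  set (d := hyper _ _ _ m).
  assert (HN := pos_INR n). assert (HM := pos_INR m).
  assert (E2 : INR (2 * m) = (2 * INR m)%R) by (rewrite mult_INR; reflexivity).
  set (X := walk (2 * m) (S n)).
  assert (K1 : kernel (2 * m) (S n)
    = ((4 * INR m + 1) / (INR n + 2 * INR m + 2) * X)%R).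
  { unfold kernel. fold X. rewrite S_INR, E2. field. lra. }
  assert (K0 : kernel (2 * m) n
    = ((4 * INR m + 1) * (INR n + 1 - 2 * INR m) / ((INR n + 1) * (INR n + 1 / 2)) * X)%R).
  { unfold kernel. pose proof (walk_S_r (2 * m) n) as E. rewrite E2 in *. fold X in E.
    replace (walk (2 * m) n) with
      ((INR n + 1 - 2 * INR m) * (INR n + 1 + 2 * INR m) * X / ((INR n + 1) * (INR n + 1 / 2)))%R.
    { field. lra. }
    rewrite E. field. lra. }
  assert (K2 : (walk (2 * S m) (S n) * (INR n + 2 * INR (S m) + 1) / (INR n + 1)
    = (INR n - 2 * INR m) * (INR n + 1 - 2 * INR m) / ((INR n + 2 * INR m + 2) * (INR n + 1)) * X)%R).
  { replace (2 * S m)%nat with (S (S (2 * m))) by lia.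
    pose proof (walk_S_S (2 * m) n) as F1. pose proof (walk_S_S (S (2 * m)) n) as F2.
    rewrite S_INR, E2 in F2. rewrite E2 in F1. fold X in F1.
    assert (Y1 : walk (S (2 * m)) (S n)
      = ((INR n + 1 - 2 * INR m) / (INR n + 2 * INR m + 2) * X)%R).
    { apply (Rmult_eq_reg_l (INR n + 2 * INR m + 2)); [|lra]. rewrite F1. field. lra. }
    assert (Y2 : walk (S (S (2 * m))) (S n)
      = ((INR n - 2 * INR m) / (INR n + 2 * INR m + 3) * walk (S (2 * m)) (S n))%R).
    { apply (Rmult_eq_reg_l (INR n + 2 * INR m + 3)); [|lra].
      transitivity ((INR n + 1 - (2 * INR m + 1)) * walk (S (2 * m)) (S n))%R.
      - rewrite <- F2. ring.
      - field. lra. }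
    rewrite Y2, Y1, S_INR. field. lra. }
  rewrite K1, K0, K2. clearbody X d. clear K1 K0 K2 E2.
  rewrite RtoC_INR_S.
  rewrite !RtoC_mult, !RtoC_div, !RtoC_mult, !RtoC_plus, !RtoC_minus, !RtoC_plus, !RtoC_mult.
  all: try nra. all: try (repeat apply Rmult_integral_contrapositive_currified; lra).
  rewrite (RtoC_div 1 2) by lra.
  set (N := RtoC (INR n)). set (M := RtoC (INR m)).
  assert (N1 : N + 1 <> 0) by (unfold N; rewrite <- RtoC_plus; apply C_neq_0_R; lra).
  assert (N2 : M + 1 <> 0) by (unfold M; rewrite <- RtoC_plus; apply C_neq_0_R; lra).
  assert (N3 : N + 2 * M + 2 <> 0).
  { unfold N, M. rewrite <- RtoC_mult, <- !RtoC_plus. apply C_neq_0_R. lra. }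
  assert (N4 : N + 2 * M + 1 <> 0).
  { unfold N, M. rewrite <- RtoC_mult, <- !RtoC_plus. apply C_neq_0_R. lra. }
  assert (N5 : 2 * N + 1 <> 0).
  { unfold N. rewrite <- RtoC_mult, <- !RtoC_plus. apply C_neq_0_R. lra. }
  assert (N6 : 2 * b + 1 + 2 * M <> 0).
  { apply C_neq_0_of_Re. unfold M, Re. unfold Re in Hb. simpl. lra. }
  field. repeat split; try assumption.
  - replace (b * 2 + 1 + M * 2) with (2 * b + 1 + 2 * M) by ring. exact N6.
  - rewrite Cmult_comm. exact N5.
Qed.

(** Both sides satisfy the same first-order recurrence in [n]: summing [wz_step] over
    m leaves only the certificate at M+1, which vanishes because the walk cannot be
    at 2(2M+2) that early. *)
Lemma quadratic_transformation (b : C) (n M : nat) : (0 < Re b)%R -> (n <= M)%nat ->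
  hyper (1 / 2) b (2 * b) n = sum_n (expansion_term b n) M.
Proof.
  intros Hb HM. induction n as [|n IH].
  - rewrite hyper_0. clear HM. induction M as [|M IH].
    + rewrite sum_O. unfold expansion_term. rewrite hyper_0, kernel_0_r. simpl. ring.
    + rewrite sum_Sn, <- IH. unfold expansion_term at 1.
      replace (2 * S M)%nat with (S (S (2 * M))) by lia. rewrite kernel_0_r.
      unfold plus; simpl. ring.
  - assert (HS : forall K,
      (INR n + 1) * (2 * b + INR n) * sum_n (expansion_term b (S n)) K
      - (INR n + 1 / 2) * (b + INR n) * sum_n (expansion_term b n) K
      = wz_certificate b n (S K)).
    { induction K as [|K IHK].
      - rewrite !sum_O, wz_step by assumption. unfold wz_certificate at 2. simpl INR. ring.
      - rewrite !sum_Sn. unfold plus; simpl AbelianMonoid.plus. simpl.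
        transitivity (wz_certificate b n (S K) +
           (wz_certificate b n (S (S K)) - wz_certificate b n (S K))); [|ring].
        rewrite <- wz_step by assumption. rewrite <- IHK. ring. }
    specialize (HS M).
    assert (HC : (0 < Re (2 * b))%R) by (unfold Re in *; simpl; lra).
    rewrite (hyper_S _ _ _ _ HC), IH by lia.
    assert (N1 : INR n + 1 <> 0) by (rewrite <- RtoC_INR_S; apply INR_C_neq_0; lia).
    pose proof (shift_neq_0 (2 * b) n HC) as N2.
    replace (wz_certificate b n (S M)) with (RtoC 0) in HS.
    2:{ unfold wz_certificate. rewrite walk_gt by lia.
        replace (0 * (INR n + 2 * INR (S M) + 1) / (INR n + 1))%R with 0%R.
        - ring.
        - unfold Rdiv. ring. }
    assert (HS' : (INR n + 1) * (2 * b + INR n) * sum_n (expansion_term b (S n)) M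
      = (INR n + 1 / 2) * (b + INR n) * sum_n (expansion_term b n) M).
    { apply Ceq_minus. exact HS. }
    replace (sum_n (expansion_term b (S n)) M) with
      ((INR n + 1) * (2 * b + INR n) * sum_n (expansion_term b (S n)) M / ((INR n + 1) * (2 * b + INR n)))
      by (field; split; assumption).
    rewrite HS'. field. split; assumption.
Qed.

(** * Limits and dominated convergence in the complex plane *)

(** Convergence in C expressed by a real limit, which keeps the two uniform
    structures on C (a plane over R, a field over itself) out of the estimates. *)
Definition Ctends (u : nat -> C) (l : C) : Prop :=
  is_lim_seq (fun n => Cmod (u n - l)) 0.

Lemma Ctends_eps (u : nat -> C) (l : C) :
  Ctends u l <-> (forall eps : posreal, eventually (fun n => (Cmod (u n - l) < eps)%R)).
Proof.
  unfold Ctends. rewrite <- is_lim_seq_spec. unfold is_lim_seq'.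
  split; intros H eps; specialize (H eps); revert H; apply filter_imp;
    intros n; rewrite Rminus_0_r, Rabs_pos_eq by apply Cmod_ge_0; auto.
Qed.

Lemma Ctends_filterlim (u : nat -> C) (l : C) :
  Ctends u l <-> filterlim u eventually (locally (l : C_NormedModule)).
Proof.
  rewrite Ctends_eps. rewrite (filterlim_locally_ball_norm (U := C_NormedModule) u l).
  reflexivity.
Qed.

Lemma is_series_Ctends (a : nat -> C) (l : C) : is_series a l <-> Ctends (sum_n a) l.
Proof. symmetry. apply Ctends_filterlim. Qed.

Lemma Ctends_const (l : C) : Ctends (fun _ => l) l.
Proof.
  apply (is_lim_seq_ext (fun _ => 0%R)); [|apply is_lim_seq_const].
  intros _. replace (l - l) with (RtoC 0) by ring. symmetry; apply Cmod_0.
Qed.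

Lemma Ctends_ext (u v : nat -> C) (l : C) :
  (forall n, u n = v n) -> Ctends u l -> Ctends v l.
Proof. intros H. apply is_lim_seq_ext. intros n. now rewrite H. Qed.

Lemma Ctends_unique (u : nat -> C) (l l' : C) : Ctends u l -> Ctends u l' -> l = l'.
Proof.
  rewrite !Ctends_filterlim. apply (filterlim_locally_unique (V := C_NormedModule)).
Qed.

Lemma Ctends_squeeze (u : nat -> C) (l : C) (e : nat -> R) :
  (forall n, (Cmod (u n - l) <= e n)%R) -> is_lim_seq e 0 -> Ctends u l.
Proof.
  intros H He. apply (is_lim_seq_le_le (fun _ => 0%R) _ e); [|apply is_lim_seq_const|exact He].
  intros n. split; [apply Cmod_ge_0 | apply H].
Qed.

Lemma is_lim_seq_plus_0 (u v : nat -> R) :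
  is_lim_seq u 0 -> is_lim_seq v 0 -> is_lim_seq (fun n => u n + v n)%R 0.
Proof.
  intros Hu Hv. replace (Finite 0) with (Finite (0 + 0)) by (f_equal; ring).
  apply is_lim_seq_plus'; assumption.
Qed.

Lemma is_lim_seq_scal_0 (c : R) (u : nat -> R) :
  is_lim_seq u 0 -> is_lim_seq (fun n => c * u n)%R 0.
Proof.
  intros Hu. replace (Finite 0) with (Rbar_mult c 0) by (simpl; f_equal; ring).
  apply is_lim_seq_scal_l. exact Hu.
Qed.

Lemma Ctends_plus (u v : nat -> C) (l m : C) :
  Ctends u l -> Ctends v m -> Ctends (fun n => u n + v n) (l + m).
Proof.
  intros Hu Hv. eapply Ctends_squeeze; [|exact (is_lim_seq_plus_0 _ _ Hu Hv)].
  intros n. cbv beta. replace (u n + v n - (l + m)) with ((u n - l) + (v n - m)) by ring.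
  apply Cmod_triangle.
Qed.

Lemma Ctends_scal (c : C) (u : nat -> C) (l : C) :
  Ctends u l -> Ctends (fun n => c * u n) (c * l).
Proof.
  intros Hu. eapply Ctends_squeeze; [|exact (is_lim_seq_scal_0 (Cmod c) _ Hu)].
  intros n. cbv beta. replace (c * u n - c * l) with (c * (u n - l)) by ring.
  rewrite Cmod_mult. lra.
Qed.

Lemma Ctends_mult (u v : nat -> C) (l m : C) :
  Ctends u l -> Ctends v m -> Ctends (fun n => u n * v n) (l * m).
Proof.
  intros Hu Hv.
  assert (H1 : is_lim_seq (fun n => Cmod (u n - l) * Cmod (v n - m))%R 0).
  { replace (Finite 0) with (Finite (0 * 0)) by (f_equal; ring).
    apply is_lim_seq_mult'; assumption. }
  eapply Ctends_squeeze.
  2:{ apply is_lim_seq_plus_0; [exact H1|].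
      apply is_lim_seq_plus_0; [exact (is_lim_seq_scal_0 (Cmod m) _ Hu)
                               |exact (is_lim_seq_scal_0 (Cmod l) _ Hv)]. }
  intros n. cbv beta.
  replace (u n * v n - l * m) with ((u n - l) * (v n - m) + (m * (u n - l) + l * (v n - m))) by ring.
  rewrite <- !Cmod_mult.
  eapply Rle_trans; [apply Cmod_triangle|]. apply Rplus_le_compat_l, Cmod_triangle.
Qed.

Lemma Ctends_sum_n (f : nat -> nat -> C) (g : nat -> C) (M : nat) :
  (forall m, Ctends (fun p => f p m) (g m)) ->
  Ctends (fun p => sum_n (f p) M) (sum_n g M).
Proof.
  intros H. induction M as [|M IH].
  - rewrite sum_O. apply (Ctends_ext (fun p => f p O)); [|apply H].
    intros n. now rewrite sum_O.
  - rewrite sum_Sn. apply (Ctends_ext (fun p => sum_n (f p) M + f p (S M))).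
    + intros n. now rewrite sum_Sn.
    + apply Ctends_plus; [exact IH | apply H].
Qed.

Lemma Ctends_Cmod_le (u : nat -> C) (l : C) (K : R) :
  Ctends u l -> (forall n, (Cmod (u n) <= K)%R) -> (Cmod l <= K)%R.
Proof.
  intros Hu HK.
  assert (H : Rbar_le (Cmod l) (0 + K)%R).
  { apply (is_lim_seq_le (fun _ => Cmod l) (fun n => Cmod (u n - l) + K)%R).
    - intros n. replace l with (- (u n - l) + u n) at 1 by ring.
      eapply Rle_trans; [apply Cmod_triangle|]. rewrite Cmod_opp.
      apply Rplus_le_compat_l, HK.
    - apply is_lim_seq_const.
    - apply is_lim_seq_plus'; [exact Hu | apply is_lim_seq_const]. }
  simpl in H. lra.
Qed.

Lemma sum_n_diff_le (a : nat -> C) (B : nat -> R) (M p : nat) :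
  (forall m, (Cmod (a m) <= B m)%R) ->
  (Cmod (sum_n a (M + p) - sum_n a M) <= sum_n B (M + p) - sum_n B M)%R.
Proof.
  intros H. induction p as [|p IH].
  - rewrite Nat.add_0_r. replace (sum_n a M - sum_n a M) with (RtoC 0) by ring.
    rewrite Cmod_0. lra.
  - rewrite Nat.add_succ_r, !sum_Sn. unfold plus; simpl.
    replace (sum_n a (M + p) + a (S (M + p)) - sum_n a M)
      with ((sum_n a (M + p) - sum_n a M) + a (S (M + p))) by ring.
    eapply Rle_trans; [apply Cmod_triangle|]. specialize (H (S (M + p))). lra.
Qed.

Lemma series_tail_le (a : nat -> C) (l : C) (B : nat -> R) (M : nat) :
  is_series a l -> (forall m, (Cmod (a m) <= B m)%R) -> ex_series B ->
  (Cmod (l - sum_n a M) <= Series B - sum_n B M)%R.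
Proof.
  intros Ha HB HS. rewrite is_series_Ctends in Ha.
  apply (is_lim_seq_incr_n _ M) in Ha.
  apply Series_correct, (proj1 (is_series_iff_lim _ _)) in HS.
  apply (is_lim_seq_incr_n _ M) in HS.
  assert (H : Rbar_le (Cmod (l - sum_n a M)) (0 + (Series B - sum_n B M))%R).
  { apply (is_lim_seq_le (fun _ => Cmod (l - sum_n a M))
             (fun n => Cmod (sum_n a (n + M) - l) + (sum_n B (n + M) - sum_n B M))%R).
    - intros n. replace (l - sum_n a M)
        with (- (sum_n a (n + M) - l) + (sum_n a (n + M) - sum_n a M)) by ring.
      eapply Rle_trans; [apply Cmod_triangle|]. rewrite Cmod_opp.
      apply Rplus_le_compat_l. rewrite Nat.add_comm. apply sum_n_diff_le, HB.
    - apply is_lim_seq_const.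
    - apply is_lim_seq_plus'; [exact Ha|].
      apply is_lim_seq_minus'; [exact HS | apply is_lim_seq_const]. }
  simpl in H. lra.
Qed.

(** Dominated convergence for series.  Cut all the series at M: the tails are
    bounded by the tail of [B], uniformly in [p], and the finite sums converge. *)
Lemma tannery (f : nat -> nat -> C) (g : nat -> C) (B : nat -> R) (S : nat -> C) (s : C) :
  ex_series B ->
  (forall p m, (Cmod (f p m) <= B m)%R) ->
  (forall m, Ctends (fun p => f p m) (g m)) ->
  (forall p, is_series (f p) (S p)) ->
  is_series g s ->
  Ctends S s.
Proof.
  intros HB Hf Hg HS Hs. apply Ctends_eps. intros eps.
  assert (Hgb : forall m, (Cmod (g m) <= B m)%R).
  { intros m. apply (Ctends_Cmod_le _ _ _ (Hg m)). intros p. apply Hf. }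
  assert (HT : is_lim_seq (fun M => Series B - sum_n B M)%R 0).
  { replace (Finite 0) with (Finite (Series B - Series B)) by (f_equal; ring).
    apply is_lim_seq_minus'; [apply is_lim_seq_const|].
    apply is_series_iff_lim, Series_correct, HB. }
  assert (He : (0 < eps / 3)%R) by (apply Rdiv_lt_0_compat; [apply eps | lra]).
  apply is_lim_seq_spec in HT. specialize (HT (mkposreal _ He)).
  destruct HT as [M HM]. specialize (HM M (Nat.le_refl M)). simpl in HM.
  rewrite Rminus_0_r in HM.
  assert (HF := Ctends_sum_n f g M Hg). rewrite Ctends_eps in HF.
  specialize (HF (mkposreal _ He)). revert HF. apply filter_imp. intros p Hp. simpl in Hp.
  assert (H1 := series_tail_le _ _ _ M (HS p) (Hf p) HB).
  assert (H2 := series_tail_le _ _ _ M Hs Hgb HB).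
  replace (S p - s) with ((S p - sum_n (f p) M)
    + ((sum_n (f p) M - sum_n g M) + - (s - sum_n g M))) by ring.
  eapply Rle_lt_trans; [apply Cmod_triangle|].
  eapply Rle_lt_trans; [apply Rplus_le_compat_l, Cmod_triangle|].
  rewrite Cmod_opp. apply Rabs_def2 in HM. lra.
Qed.

Lemma Ctends_RtoC (u : nat -> R) (l : R) : is_lim_seq u l -> Ctends (fun n => RtoC (u n)) l.
Proof.
  intros H. unfold Ctends.
  apply (is_lim_seq_ext (fun n => Rabs (u n - l))).
  { intros n. now rewrite <- RtoC_minus, Cmod_R. }
  replace (Finite 0) with (Rbar_abs (l - l)%R) by (simpl; now rewrite Rminus_diag, Rabs_R0).
  apply is_lim_seq_abs, is_lim_seq_minus'; [exact H | apply is_lim_seq_const].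
Qed.

Lemma is_series_C_plus (a b : nat -> C) (la lb : C) :
  is_series a la -> is_series b lb -> is_series (fun n => a n + b n) (la + lb).
Proof. intros Ha Hb. exact (is_series_plus a b la lb Ha Hb). Qed.

Lemma is_series_C_scal (c : C) (a : nat -> C) (l : C) :
  is_series a l -> is_series (fun n => c * a n) (c * l).
Proof. intros Ha. exact (is_series_scal_l c a l Ha). Qed.

Lemma is_series_finite_support (a : nat -> C) (l : C) (p : nat) :
  (forall M, (p <= M)%nat -> sum_n a M = l) -> is_series a l.
Proof.
  intros H. apply is_series_Ctends.
  apply (is_lim_seq_ext_loc (fun _ => 0%R)); [|apply is_lim_seq_const].
  exists p. intros M HM. rewrite (H M HM).
  replace (l - l) with (RtoC 0) by ring. symmetry; apply Cmod_0.
Qed.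

Lemma sum_Sn_C (a : nat -> C) (n : nat) : sum_n a (S n) = (sum_n a n + a (S n) : C).
Proof. exact (sum_Sn a n). Qed.

Lemma sum_Sn_R (a : nat -> R) (n : nat) : sum_n a (S n) = (sum_n a n + a (S n))%R.
Proof. exact (sum_Sn a n). Qed.

Lemma sum_O_C (a : nat -> C) : sum_n a O = (a O : C).
Proof. exact (sum_O a). Qed.

Lemma sum_O_R (a : nat -> R) : sum_n a O = (a O : R).
Proof. exact (sum_O a). Qed.

(** * Convergence of hypergeometric series at 1 *)

(** The quantity [w] pays for each term of [p] with its own decrease, so the total of
    [p] is bounded by the value of [w] where the decrease begins. *)
Lemma decreasing_energy (w p : nat -> R) (N : nat) :
  (forall n, 0 <= w n)%R -> (forall n, 0 <= p n)%R ->
  (forall n, (N <= n)%nat -> (w (S n) + p n <= w n)%R) ->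
  ex_series p /\ exists K, forall n, (w n <= K)%R.
Proof.
  intros Hw Hp H.
  assert (HD : forall i, (sum_n (fun j => p (N + j)%nat) i + w (N + S i)%nat <= w N)%R).
  { induction i as [|i IH].
    - rewrite sum_O, Nat.add_0_r, Nat.add_1_r. specialize (H N (Nat.le_refl N)). lra.
    - rewrite sum_Sn. unfold plus; simpl.
      specialize (H (N + S i)%nat ltac:(lia)). rewrite (Nat.add_succ_r N (S i)). lra. }
  split.
  - apply (ex_series_incr_n p N).
    apply (ex_finite_lim_seq_incr _ (w N)).
    + intros n. rewrite sum_Sn. unfold plus; simpl. specialize (Hp (N + S n)%nat). lra.
    + intros n. change (sum_n (fun j => p (N + j)%nat) n <= w N)%R.
      specialize (HD n). specialize (Hw (N + S n)%nat). lra.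
  - assert (Hl : forall M, exists K, forall n, (n <= M)%nat -> (w n <= K)%R).
    { induction M as [|M [K HK]].
      - exists (w O). intros n Hn. replace n with O by lia. lra.
      - exists (Rmax K (w (S M))). intros n Hn.
        destruct (Nat.eq_dec n (S M)) as [->|]; [apply Rmax_r|].
        eapply Rle_trans; [apply HK; lia | apply Rmax_l]. }
    destruct (Hl N) as [K HK]. exists K. intros n.
    destruct (Nat.le_gt_cases n N) as [Hn|Hn]; [apply HK, Hn|].
    replace n with (N + S (n - N - 1))%nat by lia.
    eapply Rle_trans; [|apply (HK N); lia].
    specialize (HD (n - N - 1)%nat).
    assert (0 <= sum_n (fun j => p (N + j)%nat) (n - N - 1))%R.
    { generalize (n - N - 1)%nat. intros i. induction i as [|i IH].
      - rewrite sum_O. apply Hp.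
      - rewrite sum_Sn. unfold plus; simpl. specialize (Hp (N + S i)%nat). lra. }
    lra.
Qed.

(** Raabe's test with a logarithmic weight: n H_n x_n decreases by at least
    (delta/2) H_n x_n once H_n is larger than 2/delta, so [decreasing_energy]
    applies to it. *)
Lemma raabe_harmonic (x : nat -> R) (delta : R) :
  (0 < delta)%R -> (forall n, 0 <= x n)%R ->
  eventually (fun n => (INR (S n) * x (S n) <= (INR n - delta) * x n)%R) ->
  ex_series (fun n => x n * harmonic n)%R /\ is_lim_seq (fun n => INR n * x n)%R 0.
Proof.
  intros Hd Hx [N0 HN].
  pose proof is_lim_seq_harmonic as HH. apply is_lim_seq_spec in HH.
  destruct (HH (2 / delta)%R) as [N1 HN1].
  destruct (decreasing_energy (fun n => INR n * harmonic n * x n)%R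
    (fun n => delta / 2 * (x n * harmonic n))%R (N0 + N1)) as [Hs [K HK]].
  - intros n. apply Rmult_le_pos; [|apply Hx].
    apply Rmult_le_pos; [apply pos_INR | apply harmonic_ge_0].
  - intros n. apply Rmult_le_pos; [lra|].
    apply Rmult_le_pos; [apply Hx | apply harmonic_ge_0].
  - intros n Hn. specialize (HN n ltac:(lia)). specialize (HN1 n ltac:(lia)).
    pose proof (Hx n) as Hxn. pose proof (harmonic_ge_0 (S n)) as Hh.
    pose proof (harmonic_ge_0 n) as Hh0.
    replace (INR (S n) * harmonic (S n) * x (S n))%R
      with (harmonic (S n) * (INR (S n) * x (S n)))%R by ring.
    apply (Rmult_le_compat_l _ _ _ Hh) in HN.
    rewrite harmonic_S in *.
    assert (HS : (0 < INR (S n))%R) by (apply lt_0_INR; lia).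
    assert (Hq : (/ INR (S n) * (INR n - delta) <= 1)%R).
    { apply (Rmult_le_reg_l (INR (S n))); [exact HS|].
      rewrite <- Rmult_assoc, Rinv_r, Rmult_1_l, Rmult_1_r by lra.
      rewrite S_INR. lra. }
    assert (Hd2 : (2 < delta * harmonic n)%R).
    { apply (Rmult_lt_compat_l delta) in HN1; [|exact Hd].
      replace (delta * (2 / delta))%R with 2%R in HN1 by (field; lra). exact HN1. }
    apply (Rmult_le_compat_r (x n)) in Hq; [|exact Hxn].
    apply Rlt_le, (Rmult_le_compat_r (x n)) in Hd2; [|exact Hxn].
    nra.
  - split.
    + apply (ex_series_ext (fun n => (2 / delta) * (delta / 2 * (x n * harmonic n)))%R).
      { intros n. change (@eq R (2 / delta * (delta / 2 * (x n * harmonic n)))%R (x n * harmonic n)%R).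
        field. lra. }
      exact (ex_series_scal_l (2 / delta)%R (fun n => delta / 2 * (x n * harmonic n))%R Hs).
    + apply (is_lim_seq_le_le_loc (fun _ => 0%R) _ (fun n => K * / harmonic n)%R).
      * exists 1%nat. intros n Hn. split; [apply Rmult_le_pos; [apply pos_INR | apply Hx]|].
        assert (Hh : (0 < harmonic n)%R).
        { destruct n as [|n]; [lia|]. rewrite harmonic_S. pose proof (harmonic_ge_0 n).
          assert (0 < / INR (S n))%R by (apply Rinv_0_lt_compat, lt_0_INR; lia). lra. }
        apply (Rmult_le_reg_r (harmonic n)); [exact Hh|].
        replace (K * / harmonic n * harmonic n)%R with K by (field; lra).
        specialize (HK n). lra.
      * apply is_lim_seq_const.
      * apply is_lim_seq_scal_0. apply (is_lim_seq_inv harmonic p_infty); [|discriminate].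
        apply is_lim_seq_harmonic.
Qed.

Lemma eventually_INR_ge (K : R) : eventually (fun n => (K <= INR n)%R).
Proof.
  pose proof is_lim_seq_INR as H. apply is_lim_seq_spec in H. specialize (H K).
  revert H. apply filter_imp. intros n Hn. lra.
Qed.

Lemma Cmod_shift_lower (x : C) (n : nat) : (Re x + INR n <= Cmod (x + INR n))%R.
Proof.
  eapply Rle_trans; [|apply re_le_Cmod]. eapply Rle_trans; [|apply Rle_abs].
  unfold Re; simpl. lra.
Qed.

Lemma Cmod_shift_upper (x : C) (e : R) : (0 < e)%R ->
  eventually (fun n => (Cmod (x + INR n) <= INR n + (Re x + e))%R).
Proof.
  intros He.
  generalize (eventually_INR_ge (Im x ^ 2 / (2 * e) - Re x)), (eventually_INR_ge (- Re x)).
  intros H1 H2. generalize (filter_and _ _ H1 H2). apply filter_imp.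
  intros n [H H'].
  assert (H3 : (Im x ^ 2 <= 2 * e * (INR n + Re x))%R).
  { apply (Rmult_le_compat_l (2 * e)) in H; [|lra].
    replace (2 * e * (Im x ^ 2 / (2 * e) - Re x))%R with (Im x ^ 2 - 2 * e * Re x)%R in H
      by (field; lra). lra. }
  unfold Cmod. rewrite <- (sqrt_pow2 (INR n + (Re x + e))) by lra.
  apply sqrt_le_1_alt. unfold Re, Im in *. simpl in *. nra.
Qed.

Lemma Cmod_INR_S (n : nat) : Cmod (INR n + 1) = INR (S n).
Proof.
  rewrite <- RtoC_INR_S, Cmod_R. apply Rabs_pos_eq, pos_INR.
Qed.

(** The ratio of consecutive terms has modulus 1 - (1 + s)/n + O(1/n^2), where s is
    the real part of c - a - b. *)
Lemma hyper_raabe (a b c : C) : (0 < Re c)%R -> (0 < Re (c - a - b))%R ->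
  ex_series (fun n => Cmod (hyper a b c n) * harmonic n)%R
  /\ is_lim_seq (fun n => INR n * Cmod (hyper a b c n))%R 0.
Proof.
  intros Hc Hs. set (s := Re (c - a - b)) in *.
  apply (raabe_harmonic _ (s / 4)); [lra | intros n; apply Cmod_ge_0|].
  set (al := (Re a + s / 4)%R). set (be := (Re b + s / 4)%R).
  assert (Hsum : (al + be = Re c - s / 2)%R).
  { unfold al, be, s, Re. simpl. lra. }
  generalize (Cmod_shift_upper a (s / 4) ltac:(lra)), (Cmod_shift_upper b (s / 4) ltac:(lra)),
    (eventually_INR_ge (s / 4)), (eventually_INR_ge ((al * be + s / 4 * Re c) / (s / 4))).
  intros H1 H2 H3 H4.
  generalize (filter_and _ _ (filter_and _ _ H1 H2) (filter_and _ _ H3 H4)).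
  apply filter_imp. clear H1 H2 H3 H4. intros n [[H1 H2] [H3 H4]].
  fold al in H1. fold be in H2.
  rewrite (hyper_S _ _ _ _ Hc), Cmod_mult, Cmod_div, !Cmod_mult, Cmod_INR_S.
  2:{ apply Cmult_neq_0; [rewrite <- RtoC_INR_S; apply INR_C_neq_0; lia | apply shift_neq_0, Hc]. }
  pose proof (Cmod_shift_lower c n) as HL. pose proof (pos_INR n).
  assert (HS : (0 < INR (S n))%R) by (apply lt_0_INR; lia).
  set (X := Cmod (hyper a b c n)). assert (HX : (0 <= X)%R) by apply Cmod_ge_0.
  replace (INR (S n) * (Cmod (a + INR n) * Cmod (b + INR n)
     / (INR (S n) * Cmod (c + INR n)) * X))%R
   with (Cmod (a + INR n) * Cmod (b + INR n) / Cmod (c + INR n) * X)%R by (field; lra).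
  apply Rmult_le_compat_r; [exact HX|].
  apply Rle_div_l; [lra|].
  eapply Rle_trans; [apply Rmult_le_compat; [apply Cmod_ge_0|apply Cmod_ge_0|exact H1|exact H2]|].
  apply Rle_trans with ((INR n - s / 4) * (Re c + INR n))%R.
  - apply (Rmult_le_compat_l (s / 4)) in H4; [|lra].
    replace (s / 4 * ((al * be + s / 4 * Re c) / (s / 4)))%R with (al * be + s / 4 * Re c)%R in H4
      by (field; lra).
    nra.
  - apply Rmult_le_compat_l; lra.
Qed.

Lemma hyper_abs_series (a b c : C) : (0 < Re c)%R -> (0 < Re (c - a - b))%R ->
  ex_series (fun n => Cmod (hyper a b c n)).
Proof.
  intros Hc Hs. destruct (hyper_raabe a b c Hc Hs) as [H _].
  apply ex_series_incr_1. apply (ex_series_incr_1 (fun n => Cmod _ * _)%R) in H.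
  refine (@ex_series_le R_AbsRing R_CompleteNormedModule _ _ _ H).
  intros n. change (Rabs (Cmod (hyper a b c (S n))) <= Cmod (hyper a b c (S n)) * harmonic (S n))%R.
  rewrite Rabs_pos_eq by apply Cmod_ge_0.
  rewrite <- (Rmult_1_r (Cmod _)) at 1. apply Rmult_le_compat_l; [apply Cmod_ge_0|].
  clear. induction n as [|n IH]; rewrite harmonic_S.
  - rewrite harmonic_0. simpl. lra.
  - assert (0 < / INR (S (S n)))%R by (apply Rinv_0_lt_compat, lt_0_INR; lia). lra.
Qed.

(** A total sum operator, so that the sums of a family of series form a sequence. *)
Definition Cseries_sum (a : nat -> C) : C := iota (fun l : C_CompleteNormedModule => is_series a l).

Lemma Cseries_sum_correct (a : nat -> C) :
  ex_series (fun n => Cmod (a n)) -> is_series a (Cseries_sum a).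
Proof.
  intros H.
  destruct (@ex_series_le C_AbsRing C_CompleteNormedModule a _ (fun n => Rle_refl _) H) as [l Hl].
  replace (Cseries_sum a) with l; [exact Hl|].
  symmetry. apply iota_unique; [|exact Hl].
  intros y Hy. apply (Ctends_unique (sum_n a)); apply is_series_Ctends; assumption.
Qed.

Lemma Re_shift (c : C) (p : nat) : Re (c + INR p) = (Re c + INR p)%R.
Proof. unfold Re; simpl. reflexivity. Qed.

Lemma hyper_shift (a b c : C) (n : nat) : (0 < Re c)%R ->
  (c + INR n) * hyper a b (c + 1) n = c * hyper a b c n.
Proof.
  intros Hc.
  assert (Hc1 : (0 < Re (c + 1))%R) by (unfold Re in *; simpl; lra).
  induction n as [|n IH].
  - rewrite !hyper_0. simpl. ring.
  - rewrite !hyper_S by assumption.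
    assert (N1 := shift_neq_0 c n Hc). assert (N2 := shift_neq_0 (c + 1) n Hc1).
    assert (N3 : INR n + 1 <> 0) by (rewrite <- RtoC_INR_S; apply INR_C_neq_0; lia).
    rewrite RtoC_INR_S.
    transitivity ((a + INR n) * (b + INR n) / (INR n + 1) * ((c + INR n) * hyper a b (c + 1) n)
       / (c + INR n)).
    + field. repeat split; assumption.
    + rewrite IH. field. split; assumption.
Qed.

(** The combination of the two series telescopes termwise, with primitive
    - c n t_n, where t_n is the term of the first series; and n t_n tends to 0. *)
Lemma gauss_contiguous (a b c G G' : C) :
  (0 < Re c)%R -> (0 < Re (c - a - b))%R ->
  is_series (hyper a b c) G -> is_series (hyper a b (c + 1)) G' ->
  c * (c - a - b) * G = (c - a) * (c - b) * G'.
Proof.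
  intros Hc Hs HG HG'. rewrite is_series_Ctends in HG, HG'.
  assert (HT : forall N, c * (c - a - b) * sum_n (hyper a b c) N
     + - ((c - a) * (c - b)) * sum_n (hyper a b (c + 1)) N
     = - (c * (INR (S N) * hyper a b c (S N)))).
  { assert (Hstep : forall n, c * (c - a - b) * hyper a b c n
       + - ((c - a) * (c - b)) * hyper a b (c + 1) n
       = c * (INR n * hyper a b c n) - c * (INR (S n) * hyper a b c (S n))).
    { intros n. assert (N1 := shift_neq_0 c n Hc).
      assert (N3 : INR n + 1 <> 0) by (rewrite <- RtoC_INR_S; apply INR_C_neq_0; lia).
      rewrite hyper_S, RtoC_INR_S by assumption.
      replace (hyper a b (c + 1) n) with (c * hyper a b c n / (c + INR n)).
      - field. split; assumption.
      - rewrite <- hyper_shift by assumption. field. assumption. }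
    induction N as [|N IH].
    - rewrite !sum_O, Hstep. simpl INR. ring.
    - rewrite !sum_Sn. unfold plus; simpl AbelianMonoid.plus.
      transitivity ((c * (c - a - b) * sum_n (hyper a b c) N
         + - ((c - a) * (c - b)) * sum_n (hyper a b (c + 1)) N)
        + (c * (c - a - b) * hyper a b c (S N) + - ((c - a) * (c - b)) * hyper a b (c + 1) (S N))).
      + simpl. ring.
      + rewrite IH, Hstep. ring. }
  assert (HL : Ctends (fun N => c * (c - a - b) * sum_n (hyper a b c) N
     + - ((c - a) * (c - b)) * sum_n (hyper a b (c + 1)) N)
     (c * (c - a - b) * G + - ((c - a) * (c - b)) * G')).
  { apply Ctends_plus; apply Ctends_scal; assumption. }
  assert (HR : Ctends (fun N => - (c * (INR (S N) * hyper a b c (S N)))) 0).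
  { destruct (hyper_raabe a b c Hc Hs) as [_ H0].
    apply is_lim_seq_incr_1 in H0.
    eapply Ctends_squeeze; [|exact (is_lim_seq_scal_0 (Cmod c) _ H0)].
    intros n. cbv beta.
    replace (- (c * (INR (S n) * hyper a b c (S n))) - 0)
      with (- (c * (INR (S n) * hyper a b c (S n)))) by ring.
    rewrite Cmod_opp, !Cmod_mult, Cmod_R, Rabs_pos_eq by apply pos_INR. lra. }
  apply (Ctends_ext _ _ _ HT) in HL.
  assert (E := Ctends_unique _ _ _ HL HR).
  apply Ceq_minus. rewrite <- E. ring.
Qed.

(** Shifting c to the right increases the modulus of every factor of (c)_m.  The
    series with parameter c therefore dominates all its shifts. *)
Lemma hyper_shift_le (a b c : C) (p m : nat) : (0 < Re c)%R ->
  (Cmod (hyper a b (c + INR p) m) <= Cmod (hyper a b c m))%R.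
Proof.
  intros Hc. assert (Hp := pos_INR p).
  assert (Hcp : (0 < Re (c + INR p))%R) by (rewrite Re_shift; lra).
  induction m as [|m IH]; [rewrite !hyper_0; lra|].
  rewrite !hyper_S, !(Cmod_mult _ (hyper _ _ _ _)) by assumption.
  apply Rmult_le_compat; try apply Cmod_ge_0; [|exact IH].
  assert (N3 : INR m + 1 <> 0) by (rewrite <- RtoC_INR_S; apply INR_C_neq_0; lia).
  rewrite !Cmod_div by (apply Cmult_neq_0; [exact N3 | apply shift_neq_0; assumption]).
  unfold Rdiv. apply Rmult_le_compat_l; [apply Cmod_ge_0|].
  pose proof (Cmod_shift_lower c m). pose proof (pos_INR m).
  rewrite !Cmod_mult, Cmod_INR_S.
  assert (0 < INR (S m))%R by (apply lt_0_INR; lia).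
  apply Rinv_le_contravar.
  - apply Rmult_lt_0_compat; lra.
  - apply Rmult_le_compat_l; [lra|].
    unfold Cmod. apply sqrt_le_1_alt. unfold Re in Hc. simpl. nra.
Qed.

Lemma gauss_sum_limit (a b c : C) (G : nat -> C) :
  (0 < Re c)%R -> (0 < Re (c - a - b))%R ->
  (forall p, is_series (hyper a b (c + INR p)) (G p)) -> Ctends G 1.
Proof.
  intros Hc Hs HG.
  apply (tannery (fun p => hyper a b (c + INR p)) (fun m => match m with O => 1 | S _ => 0 end)
           (fun m => Cmod (hyper a b c m))).
  - apply hyper_abs_series; assumption.
  - intros p m. apply hyper_shift_le, Hc.
  - intros [|m].
    + apply (Ctends_ext (fun _ => 1)); [intros n; symmetry; apply hyper_0 | apply Ctends_const].
    + set (K := (Cmod ((a + INR m) * (b + INR m)) / INR (S m) * Cmod (hyper a b c m))%R).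
      apply (Ctends_squeeze _ _ (fun p => K * / (Re c + INR p))%R).
      * intros p. pose proof (pos_INR p). pose proof (pos_INR m).
        assert (Hcp : (0 < Re (c + INR p))%R) by (rewrite Re_shift; lra).
        replace (hyper a b (c + INR p) (S m) - 0) with (hyper a b (c + INR p) (S m)) by ring.
        assert (N3 : INR m + 1 <> 0) by (rewrite <- RtoC_INR_S; apply INR_C_neq_0; lia).
        rewrite hyper_S, (Cmod_mult _ (hyper _ _ _ _)), Cmod_div, (Cmod_mult (INR m + 1)), Cmod_INR_S
          by (first [assumption | apply Cmult_neq_0; [exact N3 | apply shift_neq_0; assumption]]).
        assert (HS : (0 < INR (S m))%R) by (apply lt_0_INR; lia).
        pose proof (Cmod_shift_lower (c + INR p) m) as HL. rewrite Re_shift in HL.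
        unfold K.
        replace (Cmod ((a + INR m) * (b + INR m)) / INR (S m) * Cmod (hyper a b c m) * / (Re c + INR p))%R
          with (Cmod ((a + INR m) * (b + INR m)) / INR (S m) * / (Re c + INR p) * Cmod (hyper a b c m))%R by ring.
        apply Rmult_le_compat; [ | apply Cmod_ge_0 | | apply hyper_shift_le, Hc].
        -- apply Rmult_le_pos; [apply Cmod_ge_0|]. apply Rlt_le, Rinv_0_lt_compat.
           apply Rmult_lt_0_compat; lra.
        -- unfold Rdiv. rewrite Rmult_assoc. apply Rmult_le_compat_l; [apply Cmod_ge_0|].
           rewrite Rinv_mult. apply Rmult_le_compat_l; [apply Rlt_le, Rinv_0_lt_compat, HS|].
           apply Rinv_le_contravar; lra.
      * apply is_lim_seq_scal_0. apply (is_lim_seq_inv _ p_infty); [|discriminate].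
        eapply is_lim_seq_plus; [apply is_lim_seq_const | apply is_lim_seq_INR | reflexivity].
  - exact HG.
  - apply is_series_Ctends. apply (Ctends_ext (fun _ => 1)); [|apply Ctends_const].
    intros n. induction n as [|n IH]; [now rewrite sum_O|].
    rewrite sum_Sn, <- IH. unfold plus; simpl. ring.
Qed.

(** * The transformation of the harmonic sums *)

Lemma transformed_params_pos (b : C) : (1 / 2 < Re b)%R ->
  (0 < Re (b + 1 / 2))%R /\ (0 < Re (b + 1 / 2 - 1 / 2 - (1 - b)))%R.
Proof.
  intros Hb. rewrite Re_plus_half. split; [lra|].
  replace (b + 1 / 2 - 1 / 2 - (1 - b)) with (2 * b - 1) by field.
  unfold Re in *; simpl. lra.
Qed.

Lemma transformed_harmonic_ex_series (b : C) : (1 / 2 < Re b)%R ->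
  ex_series (fun m => Cmod (transformed b m) * harmonic (2 * m))%R.
Proof.
  intros Hb. destruct (transformed_params_pos b Hb) as [Hc Hs].
  refine (@ex_series_le R_AbsRing R_CompleteNormedModule _
            (fun m => Cmod (transformed b m) * harmonic m + Cmod (transformed b m))%R _ _).
  - intros m. change (Rabs (Cmod (transformed b m) * harmonic (2 * m)) <= Cmod (transformed b m) * harmonic m + Cmod (transformed b m))%R.
    pose proof (Cmod_ge_0 (transformed b m)).
    rewrite Rabs_pos_eq by (apply Rmult_le_pos; [assumption | apply harmonic_ge_0]).
    pose proof (harmonic_double_le m). nra.
  - apply (ex_series_plus (fun m => Cmod (transformed b m) * harmonic m)%R (fun m => Cmod (transformed b m))).
    + apply hyper_raabe; assumption.
    + apply hyper_abs_series; assumption.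
Qed.

(** The expansion of each term is a finite sum, so exchanging the order of summation
    is harmless for partial sums. *)
Lemma transformed_partial_sum (b : C) (p M : nat) : (1 / 2 < Re b)%R -> (p <= M)%nat ->
  sum_n (fun m => transformed b m * sum_n (fun n => kernel (2 * m) n * harmonic n)%R p) M
  = sum_n (fun n => hyper (1 / 2) b (2 * b) n * harmonic n) p.
Proof.
  intros Hb HM. match goal with |- ?x = ?y => change (@eq C x y) end.
  induction p as [|p IH].
  - rewrite sum_O_C, harmonic_0.
    transitivity (RtoC 0); [|ring]. clear HM.
    induction M as [|M IH]; rewrite ?sum_O_C, ?sum_Sn_C.
    + rewrite sum_O_R, harmonic_0, Rmult_0_r. ring.
    + rewrite IH, sum_O_R, harmonic_0, Rmult_0_r. ring.
  - rewrite sum_Sn_C, <- IH by lia.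
    rewrite (quadratic_transformation b (S p) M) by (lra || lia). clear IH HM.
    induction M as [|M IH]; match goal with |- ?x = ?y => change (@eq C x y) end.
    + rewrite !sum_O_C, sum_Sn_R, RtoC_plus, RtoC_mult. unfold expansion_term. ring.
    + rewrite !(sum_Sn_C _ M), IH, sum_Sn_R, RtoC_plus, RtoC_mult. unfold expansion_term at 3. ring.
Qed.

(** Passing to the limit in [transformed_partial_sum] by Tannery's theorem: the inner
    sums increase to the values of [kernel_harmonic_series], which give the
    majorant as well as the limit. *)
Lemma harmonic_transform (b G V : C) : (1 / 2 < Re b)%R ->
  is_series (transformed b) G -> is_series (fun m => transformed b m * harmonic (2 * m)) V ->
  is_series (fun n => hyper (1 / 2) b (2 * b) n * harmonic n) (4 * V + 4 * ln 2 * G).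
Proof.
  intros Hb HG HV. apply is_series_Ctends.
  set (w := fun m => (4 * (harmonic (2 * m) + ln 2))%R).
  assert (Hl2 : (0 <= ln 2)%R) by (rewrite <- ln_1; apply ln_le; lra).
  assert (Hw : forall m, (0 <= w m)%R).
  { intros m. unfold w. pose proof (harmonic_ge_0 (2 * m)). lra. }
  apply (tannery
    (fun p m => transformed b m * sum_n (fun n => kernel (2 * m) n * harmonic n)%R p)
    (fun m => transformed b m * w m) (fun m => Cmod (transformed b m) * w m)%R).
  - apply (ex_series_ext (fun m => 4 * (Cmod (transformed b m) * harmonic (2 * m)) + 4 * ln 2 * Cmod (transformed b m))%R).
    { intros m. unfold w.
      match goal with |- ?x = ?y => change (@eq R x y) end. ring. }
    destruct (transformed_params_pos b Hb) as [Hc Hs].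
    apply (ex_series_plus (fun m => 4 * (Cmod (transformed b m) * harmonic (2 * m)))%R
             (fun m => 4 * ln 2 * Cmod (transformed b m))%R).
    + exact (ex_series_scal_l 4%R _ (transformed_harmonic_ex_series b Hb)).
    + exact (ex_series_scal_l (4 * ln 2)%R _ (hyper_abs_series _ _ _ Hc Hs)).
  - intros p m. rewrite Cmod_mult, Cmod_R.
    apply Rmult_le_compat_l; [apply Cmod_ge_0|].
    destruct (sum_n_le_total (fun n => kernel (2 * m) n * harmonic n)%R (w m) p) as [H1 H2].
    + intros n. apply Rmult_le_pos; [apply kernel_ge_0 | apply harmonic_ge_0].
    + apply kernel_harmonic_series.
    + rewrite Rabs_pos_eq; assumption.
  - intros m. apply Ctends_scal, Ctends_RtoC. apply (kernel_harmonic_series (2 * m)).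
  - intros p. apply (is_series_finite_support _ _ p). intros M HM.
    apply transformed_partial_sum; assumption.
  - apply (is_series_ext (fun m => 4 * (transformed b m * harmonic (2 * m)) + 4 * ln 2 * transformed b m)).
    { intros m. unfold w.
      match goal with |- ?x = ?y => change (@eq C x y) end.
      rewrite RtoC_mult, RtoC_plus. ring. }
    apply is_series_C_plus; apply is_series_C_scal; assumption.
Qed.

(** * Improper integrals over the half-line *)

Local Notation zero_plus := (at_right 0).
Local Notation infty := (Rbar_locally p_infty).

Lemma positive_ends : filter_prod zero_plus infty (fun ab => 0 < fst ab /\ 0 < snd ab)%R.
Proof.
  exists (fun a => 0 < a)%R (fun b => 0 < b)%R.
  - exists (mkposreal 1 Rlt_0_1). intros y _ Hy. exact Hy.
  - exists 0%R. intros x Hx. exact Hx.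
  - intros x y Hx Hy. split; assumption.
Qed.

Lemma ordered_ends : filter_prod zero_plus infty (fun ab => 0 < fst ab /\ fst ab <= snd ab)%R.
Proof.
  exists (fun a => 0 < a < 1)%R (fun b => 1 < b)%R.
  - exists (mkposreal 1 Rlt_0_1). intros y Hy Hy'. split; [exact Hy'|].
    change (Rabs (y - 0) < 1)%R in Hy. apply Rabs_def2 in Hy. lra.
  - exists 1%R. intros x Hx. exact Hx.
  - intros x y Hx Hy. simpl. lra.
Qed.

(** Phrased with integrals over compact intervals rather than with derivatives, so
    that it serves for complex-valued integrands treated by components. *)
Lemma is_RInt_gen_primitive {V : CompleteNormedModule R_AbsRing} (F f : R -> V) (l0 l1 : V) :
  (forall a b, 0 < a -> 0 < b -> is_RInt f a b (minus (F b) (F a)))%R ->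
  filterlim F zero_plus (locally l0) -> filterlim F infty (locally l1) ->
  is_RInt_gen f zero_plus infty (minus l1 l0).
Proof.
  intros HF H0 H1. unfold is_RInt_gen.
  apply (filterlimi_lim_ext_loc (fun ab => minus (F (snd ab)) (F (fst ab)))).
  - generalize positive_ends. apply filter_imp. intros [a b] [Ha Hb]. apply HF; assumption.
  - apply (filterlim_comp_2 (G := locally l1) (H := locally (opp l0))
             (fun ab => F (snd ab)) (fun ab => opp (F (fst ab))) plus).
    + eapply filterlim_comp; [apply filterlim_snd | exact H1].
    + apply (filterlim_comp _ _ _ (fun ab : R * R => F (fst ab)) opp _ (locally l0));
        [|apply (filterlim_opp l0)].
      eapply filterlim_comp; [apply filterlim_fst | exact H0].
    + exact (filterlim_plus l1 (opp l0)).
Qed.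

Lemma minus_plus_middle {G : AbelianGroup} (p u q : G) :
  minus (plus (plus p u) q) u = plus p q.
Proof.
  unfold minus. rewrite <- (plus_assoc p u q), (plus_comm u q), (plus_assoc p q u).
  transitivity (plus (plus p q) (plus u (opp u))).
  - symmetry. exact (plus_assoc (plus p q) u (opp u)).
  - rewrite plus_opp_r. apply plus_zero_r.
Qed.

(** Cauchy's criterion: changing the endpoints changes the integral of [f] by at most
    the corresponding variation of the primitive [G] of its majorant. *)
Lemma ex_RInt_gen_dominated {V : CompleteNormedModule R_AbsRing}
    (f : R -> V) (g G : R -> R) (l0 l1 : R) :
  (forall t, 0 < t -> continuous f t)%R ->
  (forall a b, 0 < a -> 0 < b -> is_RInt g a b (G b - G a))%R ->
  (forall t, 0 < t -> norm (f t) <= g t)%R ->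
  filterlim G zero_plus (locally l0) -> filterlim G infty (locally l1) ->
  ex_RInt_gen f zero_plus infty.
Proof.
  intros Hf HG Hfg H0 H1.
  assert (Hex : forall a b, (0 < a -> 0 < b -> ex_RInt f a b)%R).
  { intros a b Ha Hb. apply ex_RInt_continuous. intros t [Ht _]. apply Hf.
    eapply Rlt_le_trans; [|exact Ht]. apply Rmin_glb_lt; assumption. }
  assert (Hle : forall a b l, (0 < a -> a <= b -> is_RInt f a b l -> norm l <= Rabs (G b - G a))%R).
  { intros a b l Ha Hab Hl. eapply Rle_trans; [|apply Rle_abs].
    apply (norm_RInt_le f g a b l (G b - G a)%R Hab).
    - intros t Ht. apply Hfg. lra.
    - exact Hl.
    - apply HG; lra. }
  assert (Hbd : forall a b l, (0 < a -> 0 < b -> is_RInt f a b l -> norm l <= Rabs (G b - G a))%R).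
  { intros a b l Ha Hb Hl. destruct (Rle_lt_dec a b) as [Hab|Hab].
    - apply Hle; assumption.
    - rewrite <- norm_opp, Rabs_minus_sym. apply Hle; [exact Hb | lra|].
      apply is_RInt_swap. exact Hl. }
  refine (proj1 (filterlimi_locally_cauchy (U := V)
    (F := filter_prod zero_plus infty) (fun ab : R * R => is_RInt f (fst ab) (snd ab)) _) _).
  { generalize positive_ends. apply filter_imp. intros [a b] [Ha Hb]. simpl in *.
    split; [apply Hex; assumption|].
    intros y1 y2 E1 E2. rewrite <- (is_RInt_unique _ _ _ _ E1). apply is_RInt_unique, E2. }
  intros eps.
  assert (He : (0 < eps / 4)%R) by (apply Rdiv_lt_0_compat; [apply eps | lra]).
  set (e := mkposreal _ He).
  exists (fun ab => (0 < fst ab /\ 0 < snd ab)%R /\ (Rabs (G (fst ab) - l0) < e)%R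
    /\ (Rabs (G (snd ab) - l1) < e)%R).
  split.
  - apply filter_and; [apply positive_ends|].
    exists (fun a => Rabs (G a - l0) < e)%R (fun b => Rabs (G b - l1) < e)%R.
    + apply (H0 (fun y => Rabs (y - l0) < e)%R). exists e. intros y Hy. exact Hy.
    + apply (H1 (fun y => Rabs (y - l1) < e)%R). exists e. intros y Hy. exact Hy.
    + intros x y Hx Hy. split; assumption.
  - intros [a b] [a' b'] [[Ha Hb] [A1 B1]] [[Ha' Hb'] [A2 B2]] u v Hu Hv. simpl in *.
    destruct (Hex a' a Ha' Ha) as [p Hp]. destruct (Hex b b' Hb Hb') as [q Hq].
    assert (Hv' : is_RInt f a' b' (plus (plus p u) q)).
    { eapply is_RInt_Chasles; [|exact Hq]. eapply is_RInt_Chasles; eassumption. }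
    assert (E : v = plus (plus p u) q).
    { rewrite <- (is_RInt_unique _ _ _ _ Hv). apply is_RInt_unique, Hv'. }
    apply (norm_compat1 (K := R_AbsRing) (V := V) u v eps). rewrite E.
    replace (minus (plus (plus p u) q) u) with (plus p q).
    2:{ symmetry. exact (minus_plus_middle p u q). }
    eapply Rle_lt_trans; [apply norm_triangle|].
    assert (P1 := Hbd _ _ _ Ha' Ha Hp). assert (P2 := Hbd _ _ _ Hb Hb' Hq).
    apply Rabs_def2 in A1. apply Rabs_def2 in A2. apply Rabs_def2 in B1. apply Rabs_def2 in B2.
    assert (Q1 : (Rabs (G a - G a') <= 2 * (eps / 4))%R) by (apply Rabs_le; lra).
    assert (Q2 : (Rabs (G b' - G b) < 2 * (eps / 4))%R) by (apply Rabs_def1; lra).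
    lra.
Qed.

Lemma filterlim_squeeze_0 {T : Type} (F : (T -> Prop) -> Prop) {FF : Filter F} (f g : T -> R) :
  F (fun x => Rabs (f x) <= g x)%R -> filterlim g F (locally 0%R) -> filterlim f F (locally 0%R).
Proof.
  intros H Hg. apply filterlim_locally. intros eps.
  assert (Hg' := proj1 (filterlim_locally g 0%R) Hg eps).
  generalize (filter_and _ _ H Hg'). apply filter_imp. intros x [H1 H2].
  change (Rabs (f x - 0) < eps)%R. change (Rabs (g x - 0) < eps)%R in H2.
  rewrite Rminus_0_r in *. eapply Rle_lt_trans; [exact H1|].
  eapply Rle_lt_trans; [apply Rle_abs | exact H2].
Qed.

Lemma is_RInt_Cscal (f : R -> C) (a b : R) (z l : C) :
  is_RInt (V := C_R_NormedModule) f a b l ->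
  is_RInt (V := C_R_NormedModule) (fun t => z * f t) a b (z * l).
Proof.
  intros H.
  assert (H1 := is_RInt_fct_extend_fst f a b l H).
  assert (H2 := is_RInt_fct_extend_snd f a b l H).
  apply (is_RInt_fct_extend_pair (U := R_NormedModule) (V := R_NormedModule)
    (fun t => z * f t) a b (fst z * fst l - snd z * snd l)%R (fst z * snd l + snd z * fst l)%R); simpl.
  - exact (is_RInt_minus _ _ a b _ _ (is_RInt_scal _ a b (fst z) _ H1)
             (is_RInt_scal _ a b (snd z) _ H2)).
  - exact (is_RInt_plus _ _ a b _ _ (is_RInt_scal _ a b (fst z) _ H2)
             (is_RInt_scal _ a b (snd z) _ H1)).
Qed.

Lemma is_RInt_gen_Cscal (f : R -> C) (z l : C) :
  is_RInt_gen (V := C_R_NormedModule) f zero_plus infty l ->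
  is_RInt_gen (V := C_R_NormedModule) (fun t => z * f t) zero_plus infty (z * l).
Proof.
  intros H P HP.
  assert (HP' : locally (T := C_R_NormedModule) l (fun y => P (z * y))).
  { exact (filterlim_scal_r (V := C_NormedModule) z l P HP). }
  specialize (H _ HP'). unfold filtermapi in *. revert H. apply filter_imp. intros [a b] [y [Hy Py]].
  exists (z * y). split; [apply is_RInt_Cscal, Hy | exact Py].
Qed.

Lemma is_RInt_gen_RtoC (f : R -> R) (l : R) :
  is_RInt_gen f zero_plus infty l ->
  is_RInt_gen (V := C_R_NormedModule) (fun t => RtoC (f t)) zero_plus infty (RtoC l).
Proof.
  intros H P [eps HP].
  assert (HP' : locally l (fun y => P (RtoC y))).
  { exists eps. intros y Hy. apply HP. split; [exact Hy | apply ball_center]. }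
  specialize (H _ HP'). unfold filtermapi in *. revert H. apply filter_imp. intros [a b] [y [Hy Py]].
  exists (RtoC y). split; [|exact Py].
  apply (is_RInt_fct_extend_pair (U := R_NormedModule) (V := R_NormedModule)
    (fun t => RtoC (f t)) a b y 0%R); simpl; [exact Hy|].
  pose proof (is_RInt_const (V := R_NormedModule) a b 0%R) as H0.
  replace (scal (b - a)%R (0%R : R_NormedModule)) with 0%R in H0
    by (unfold scal; simpl; unfold mult; simpl; ring).
  exact H0.
Qed.

(** * The gamma function *)

Lemma Rcpow_eq (t : R) (z : C) :
  Rcpow t z = ((exp (Re z * ln t) * cos (Im z * ln t))%R, (exp (Re z * ln t) * sin (Im z * ln t))%R).
Proof.
  unfold Rcpow, Cexp. rewrite re_scal_r, im_scal_r. reflexivity.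
Qed.

Lemma Cmod_Rcpow (t : R) (z : C) : Cmod (Rcpow t z) = exp (Re z * ln t).
Proof.
  rewrite Rcpow_eq. unfold Cmod. simpl fst. simpl snd.
  set (e := exp _). set (th := (Im z * ln t)%R).
  replace ((e * cos th) ^ 2 + (e * sin th) ^ 2)%R with (e ^ 2)%R.
  - apply sqrt_pow2, Rlt_le, exp_pos.
  - pose proof (sin2_cos2 th) as H. unfold Rsqr in H. 
    replace ((e * cos th) ^ 2 + (e * sin th) ^ 2)%R
      with (e ^ 2 * (sin th * sin th + cos th * cos th))%R by ring.
    rewrite H. ring.
Qed.

Lemma Rcpow_neq_0 (t : R) (z : C) : Rcpow t z <> 0.
Proof. apply Cmod_gt_0. rewrite Cmod_Rcpow. apply exp_pos. Qed.

Lemma Rcpow_plus (t : R) (z w : C) : Rcpow t (z + w) = Rcpow t z * Rcpow t w.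
Proof.
  rewrite !Rcpow_eq.
  replace (Re (z + w)) with (Re z + Re w)%R by reflexivity.
  replace (Im (z + w)) with (Im z + Im w)%R by reflexivity.
  rewrite !Rmult_plus_distr_r, exp_plus, cos_plus, sin_plus.
  apply injective_projections; simpl; ring.
Qed.

Lemma Rcpow_mult_base (s t : R) (z : C) : (0 < s)%R -> (0 < t)%R ->
  Rcpow (s * t) z = Rcpow s z * Rcpow t z.
Proof.
  intros Hs Ht. rewrite !Rcpow_eq, ln_mult by assumption.
  rewrite !Rmult_plus_distr_l, exp_plus, cos_plus, sin_plus.
  apply injective_projections; simpl; ring.
Qed.

Lemma Rcpow_INR (t : R) (n : nat) : (0 < t)%R -> Rcpow t (INR n) = (t ^ n)%R.
Proof.
  intros Ht. rewrite Rcpow_eq. simpl Re. simpl Im. rewrite !Rmult_0_l, cos_0, sin_0.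
  change (exp (INR n * ln t)) with (Rpower t (INR n)).
  rewrite Rpower_pow, Rmult_1_r, Rmult_0_r by assumption. reflexivity.
Qed.

(** Powers grow more slowly than exponentials; from ln s <= s - 1 at
    s = t / (2x). *)
Lemma exp_ln_le (x : R) : (0 < x)%R ->
  exists K : R, (0 < K)%R /\ forall t, (0 < t)%R -> (exp (x * ln t) <= K * exp (t / 2))%R.
Proof.
  intros Hx. exists (exp (x * (ln (2 * x) - 1))). split; [apply exp_pos|].
  intros t Ht. rewrite <- exp_plus.
  assert (H : (ln (t / (2 * x)) <= t / (2 * x) - 1)%R).
  { assert (Hp : (0 < t / (2 * x))%R) by (apply Rdiv_lt_0_compat; lra).
    pose proof (exp_ineq1_le (ln (t / (2 * x)))) as E. rewrite exp_ln in E by exact Hp. lra. }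
  rewrite ln_div in H by lra.
  apply (Rmult_le_compat_l x) in H; [|lra].
  replace (x * (t / (2 * x) - 1))%R with (t / 2 - x)%R in H by (field; lra).
  destruct (Rle_lt_or_eq_dec (x * ln t) (x * (ln (2 * x) - 1) + t / 2)) as [L|L]; [lra| |].
  - left. apply exp_increasing, L.
  - right. now rewrite L.
Qed.

Lemma exp_ln_at_0 (x : R) : (0 < x)%R -> filterlim (fun t => exp (x * ln t)) zero_plus (locally 0%R).
Proof.
  intros Hx.
  apply (filterlim_comp _ _ _ (fun t => x * ln t)%R exp _ (Rbar_locally m_infty)).
  2:{ exact is_lim_exp_m. }
  apply (filterlim_comp _ _ _ ln (fun y => x * y)%R _ (Rbar_locally m_infty)).
  1:{ exact is_lim_ln_0. }
  replace m_infty with (Rbar_mult x m_infty) at 2.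
  - apply (filterlim_Rbar_mult_l x m_infty).
  - simpl. destruct (Rle_dec 0 x) as [H|H]; [|lra].
    destruct (Rle_lt_or_eq_dec 0 x H) as [H'|H']; [reflexivity | lra].
Qed.

Lemma exp_ln_at_oo (x : R) : (0 < x)%R -> filterlim (fun t => exp (x * ln t)) infty infty.
Proof.
  intros Hx.
  apply (filterlim_comp _ _ _ (fun t => x * ln t)%R exp _ (Rbar_locally p_infty)).
  2:{ exact is_lim_exp_p. }
  apply (filterlim_comp _ _ _ ln (fun y => x * y)%R _ (Rbar_locally p_infty)).
  1:{ exact is_lim_ln_p. }
  replace p_infty with (Rbar_mult x p_infty) at 2.
  - apply (filterlim_Rbar_mult_l x p_infty).
  - simpl. destruct (Rle_dec 0 x) as [H|H]; [|lra].
    destruct (Rle_lt_or_eq_dec 0 x H) as [H'|H']; [reflexivity | lra].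
Qed.

Definition gamma_integrand (z : C) (t : R) : C := Rcpow t (z - 1) * exp (- t).

Lemma gamma_integrand_parts (z : C) (t : R) :
  gamma_integrand z t = ((exp (- t) * (exp ((Re z - 1) * ln t) * cos (Im z * ln t)))%R,
                (exp (- t) * (exp ((Re z - 1) * ln t) * sin (Im z * ln t)))%R).
Proof.
  unfold gamma_integrand. rewrite Rcpow_eq.
  replace (Re (z - 1)) with (Re z - 1)%R by reflexivity.
  replace (Im (z - 1)) with (Im z)%R by (unfold Im; simpl; ring).
  apply injective_projections; simpl; ring.
Qed.

Lemma Cmod_gamma_integrand (z : C) (t : R) : Cmod (gamma_integrand z t) = (exp ((Re z - 1) * ln t) * exp (- t))%R.
Proof.
  unfold gamma_integrand. rewrite Cmod_mult, Cmod_Rcpow, Cmod_R, Rabs_pos_eq by apply Rlt_le, exp_pos.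
  reflexivity.
Qed.

Lemma continuous_C_pair (f g : R -> R) (t : R) :
  continuous f t -> continuous g t -> continuous (U := C_R_NormedModule) (fun t => (f t, g t)) t.
Proof.
  intros Hf Hg. apply filterlim_locally. intros eps.
  assert (Hf' := proj1 (filterlim_locally f (f t)) Hf eps).
  assert (Hg' := proj1 (filterlim_locally g (g t)) Hg eps).
  generalize (filter_and _ _ Hf' Hg'). apply filter_imp. intros x [H1 H2]. split; assumption.
Qed.

Lemma continuous_ext_C (f g : R -> C) (t : R) :
  (forall x, f x = g x) -> continuous (U := C_R_NormedModule) f t ->
  continuous (U := C_R_NormedModule) g t.
Proof. intros H. apply (continuous_ext (U := C_R_NormedModule)). exact H. Qed.

(** One majorant serves at both ends: the derivative of a multiple of
    t^x / (1 + t^x), where x = Re z, since e^(-t) (1 + t^x)^2 is bounded. *)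
Lemma ex_RInt_gen_gamma_integrand (z : C) : (0 < Re z)%R ->
  ex_RInt_gen (V := C_R_CompleteNormedModule) (gamma_integrand z) zero_plus infty.
Proof.
  intros Hz. set (x := Re z) in *.
  destruct (exp_ln_le x Hz) as [K0 [HK0 HK]].
  set (K := ((1 + K0) ^ 2 / x)%R).
  set (p := fun t => exp (x * ln t)).
  assert (HK1 : (0 < K)%R) by (apply Rdiv_lt_0_compat; [apply pow_lt; lra | lra]).
  apply (ex_RInt_gen_dominated (V := C_R_CompleteNormedModule) (gamma_integrand z)
    (fun t => K * x * p t / t / (1 + p t) ^ 2)%R
    (fun t => K * (1 - / (1 + p t)))%R (K * (1 - / (1 + 0)))%R (K * (1 - 0))%R).
  - intros t Ht. refine (continuous_ext_C _ _ _ (fun t => eq_sym (gamma_integrand_parts z t)) _).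
    apply continuous_C_pair; apply (ex_derive_continuous (V := R_NormedModule));
      auto_derive; repeat split; exact Ht.
  - intros a b Ha Hb.
    assert (Hpos : forall t, (Rmin a b <= t -> 0 < t)%R).
    { intros t. apply Rlt_le_trans, Rmin_glb_lt; assumption. }
    apply (is_RInt_derive (V := R_CompleteNormedModule) (fun t => K * (1 - / (1 + p t)))%R).
    + intros t [Ht _]. apply Hpos in Ht. unfold p.
      pose proof (exp_pos (x * ln t)). auto_derive; [repeat split; lra|]. field. lra.
    + intros t [Ht _]. apply Hpos in Ht. unfold p.
      pose proof (exp_pos (x * ln t)).
      apply (ex_derive_continuous (V := R_NormedModule)). auto_derive.
      repeat split; try lra. nra.
  - intros t Ht. rewrite <- Cmod_norm, Cmod_gamma_integrand. fold x.
    pose proof (exp_pos (x * ln t)) as Hp. fold (p t) in Hp.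
    specialize (HK t Ht). fold (p t) in HK.
    replace (exp ((x - 1) * ln t)) with (p t / t)%R.
    2:{ unfold p. replace ((x - 1) * ln t)%R with (x * ln t + - ln t)%R by ring.
        rewrite exp_plus, exp_Ropp, exp_ln by exact Ht. reflexivity. }
    replace (K * x * p t / t / (1 + p t) ^ 2)%R with (p t / t * ((1 + K0) ^ 2 / (1 + p t) ^ 2))%R.
    2:{ unfold K. field. repeat split; lra. }
    apply Rmult_le_compat_l; [apply Rlt_le, Rdiv_lt_0_compat; lra|].
    assert (He : (1 <= exp (t / 2))%R) by (rewrite <- exp_0; left; apply exp_increasing; lra).
    replace (exp (- t)) with (/ (exp (t / 2) ^ 2))%R.
    2:{ rewrite exp_Ropp. f_equal. simpl. rewrite Rmult_1_r, <- exp_plus. f_equal. field. }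
    assert (Hs : (1 + p t <= (1 + K0) * exp (t / 2))%R) by nra.
    apply (Rmult_le_reg_l (exp (t / 2) ^ 2 * (1 + p t) ^ 2)).
    + apply Rmult_lt_0_compat; apply pow_lt; lra.
    + replace (exp (t / 2) ^ 2 * (1 + p t) ^ 2 * / exp (t / 2) ^ 2)%R with ((1 + p t) ^ 2)%R
        by (field; lra).
      replace (exp (t / 2) ^ 2 * (1 + p t) ^ 2 * ((1 + K0) ^ 2 / (1 + p t) ^ 2))%R
        with (((1 + K0) * exp (t / 2)) ^ 2)%R by (field; lra).
      apply pow_incr. lra.
  - eapply (filterlim_comp _ _ _ p (fun y => K * (1 - / (1 + y)))%R); [apply exp_ln_at_0, Hz|].
    apply (ex_derive_continuous (V := R_NormedModule) (fun y => K * (1 - / (1 + y)))%R).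
    auto_derive. lra.
  - assert (Hi : filterlim (fun t => / (1 + p t))%R infty (locally 0%R)).
    { apply (filterlim_comp _ _ _ (fun t => 1 + p t)%R Rinv _ (Rbar_locally p_infty)).
      - apply (filterlim_comp _ _ _ p (fun y => 1 + y)%R _ (Rbar_locally p_infty)).
        + apply exp_ln_at_oo, Hz.
        + apply (is_lim_plus (fun _ => 1%R) (fun y => y) p_infty 1 p_infty p_infty);
            [apply is_lim_const | apply is_lim_id | reflexivity].
      - apply (filterlim_Rbar_inv p_infty). discriminate. }
    eapply (filterlim_comp _ _ _ (fun t => / (1 + p t))%R (fun y => K * (1 - y))%R); [exact Hi|].
    apply (ex_derive_continuous (V := R_NormedModule) (fun y => K * (1 - y))%R).
    auto_derive. exact I.
Qed.

Lemma CGamma_correct (z : C) : (0 < Re z)%R ->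
  is_RInt_gen (V := C_R_NormedModule) (gamma_integrand z) zero_plus infty (CGamma z).
Proof.
  intros Hz. exact (RInt_gen_correct (V := C_R_CompleteNormedModule) _ (ex_RInt_gen_gamma_integrand z Hz)).
Qed.

Lemma CGamma_unique (z l : C) :
  is_RInt_gen (V := C_R_NormedModule) (gamma_integrand z) zero_plus infty l -> CGamma z = l.
Proof.
  intros H. exact (is_RInt_gen_unique (V := C_R_CompleteNormedModule) (gamma_integrand z) l H).
Qed.

Lemma boundary_at_0 (z : C) : (0 < Re z)%R ->
  filterlim (fun t => - (Rcpow t z * exp (- t))) zero_plus (locally (T := C_R_NormedModule) (RtoC 0)).
Proof.
  intros Hz. apply (filterlim_norm_zero (V := C_R_NormedModule)).
  apply (filterlim_squeeze_0 _ _ (fun t => exp (Re z * ln t))); [|apply exp_ln_at_0, Hz].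
  exists (mkposreal 1 Rlt_0_1). intros t _ Ht.
  rewrite Rabs_pos_eq by apply norm_ge_0.
  rewrite <- Cmod_norm, Cmod_opp, Cmod_mult, Cmod_Rcpow, Cmod_R, Rabs_pos_eq by apply Rlt_le, exp_pos.
  rewrite <- (Rmult_1_r (exp (Re z * ln t))) at 2.
  apply Rmult_le_compat_l; [apply Rlt_le, exp_pos|].
  rewrite <- exp_0. left. apply exp_increasing. lra.
Qed.

Lemma boundary_at_oo (z : C) : (0 < Re z)%R ->
  filterlim (fun t => - (Rcpow t z * exp (- t))) infty (locally (T := C_R_NormedModule) (RtoC 0)).
Proof.
  intros Hz. destruct (exp_ln_le (Re z) Hz) as [K [HK0 HK]].
  apply (filterlim_norm_zero (V := C_R_NormedModule)).
  apply (filterlim_squeeze_0 _ _ (fun t => K * exp (- (t / 2)))%R).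
  - exists 0%R. intros t Ht.
    rewrite Rabs_pos_eq by apply norm_ge_0.
    rewrite <- Cmod_norm, Cmod_opp, Cmod_mult, Cmod_Rcpow, Cmod_R, Rabs_pos_eq by apply Rlt_le, exp_pos.
    specialize (HK t Ht).
    replace (- (t / 2))%R with (t / 2 + - t)%R by field. rewrite exp_plus, <- Rmult_assoc.
    apply Rmult_le_compat_r; [apply Rlt_le, exp_pos | exact HK].
  - replace (locally 0%R) with (Rbar_locally (Rbar_mult K 0)) by (simpl; now rewrite Rmult_0_r).
    apply (is_lim_scal_l (fun t => exp (- (t / 2))) K p_infty 0).
    apply (filterlim_comp _ _ _ (fun t => - (t / 2))%R exp _ (Rbar_locally m_infty)); [|exact is_lim_exp_m].
    intros P [M HM]. exists (-2 * M)%R. intros t Ht. apply HM. lra.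
Qed.

(** Integration by parts: the difference of the two integrands is the derivative of
    - t^z e^(-t), which vanishes at both ends. *)
Lemma CGamma_succ (z : C) : (0 < Re z)%R -> CGamma (z + 1) = z * CGamma z.
Proof.
  intros Hz. apply CGamma_unique.
  set (x := Re z). set (y := Im z).
  set (fr := fun t => (exp (- t) * exp (x * ln t)
     * (cos (y * ln t) - (x * cos (y * ln t) - y * sin (y * ln t)) / t))%R).
  set (fi := fun t => (exp (- t) * exp (x * ln t)
     * (sin (y * ln t) - (x * sin (y * ln t) + y * cos (y * ln t)) / t))%R).
  assert (H : is_RInt_gen (V := C_R_NormedModule) (fun t => (fr t, fi t)) zero_plus infty
                (minus (G := C_R_NormedModule) (RtoC 0) (RtoC 0))).
  { apply (is_RInt_gen_primitive (V := C_R_CompleteNormedModule)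
      (fun t => - (Rcpow t z * exp (- t)))).
    - intros a b Ha Hb.
      assert (Hpos : forall t, (Rmin a b <= t -> 0 < t)%R).
      { intros t. apply Rlt_le_trans, Rmin_glb_lt; assumption. }
      set (Fr := fun t => (- (exp (x * ln t) * cos (y * ln t) * exp (- t)))%R).
      set (Fi := fun t => (- (exp (x * ln t) * sin (y * ln t) * exp (- t)))%R).
      assert (EF : forall t, - (Rcpow t z * exp (- t)) = (Fr t, Fi t)).
      { intros t. rewrite Rcpow_eq. unfold Fr, Fi, x, y.
        apply injective_projections; simpl; ring. }
      rewrite !EF.
      apply (is_RInt_fct_extend_pair (U := R_NormedModule) (V := R_NormedModule)
               (fun t => (fr t, fi t)) a b (Fr b - Fr a)%R (Fi b - Fi a)%R); simpl.
      + apply (is_RInt_derive (V := R_CompleteNormedModule) Fr fr); intros t [Ht _]; apply Hpos in Ht.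
        * unfold Fr, fr. auto_derive; [lra|]. field. lra.
        * apply (ex_derive_continuous (V := R_NormedModule)). unfold fr. auto_derive. repeat split; lra.
      + apply (is_RInt_derive (V := R_CompleteNormedModule) Fi fi); intros t [Ht _]; apply Hpos in Ht.
        * unfold Fi, fi. auto_derive; [lra|]. field. lra.
        * apply (ex_derive_continuous (V := R_NormedModule)). unfold fi. auto_derive. repeat split; lra.
    - apply boundary_at_0, Hz.
    - apply boundary_at_oo, Hz. }
  assert (H' := is_RInt_gen_plus _ _ _ _ H (is_RInt_gen_Cscal _ z _ (CGamma_correct z Hz))).
  replace (z * CGamma z) with (plus (G := C_R_NormedModule)
    (minus (G := C_R_NormedModule) (RtoC 0) (RtoC 0)) (z * CGamma z)).
  2:{ change (RtoC 0 + - RtoC 0 + z * CGamma z = z * CGamma z). ring. }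
  refine (is_RInt_gen_ext _ _ _ _ H').
  generalize positive_ends. apply filter_imp. intros [a b] [Ha Hb] t [Ht _]. simpl in *.
  assert (Hpos : (0 < t)%R) by (eapply Rlt_trans; [|exact Ht]; apply Rmin_glb_lt; assumption).
  change ((fr t, fi t) + z * gamma_integrand z t = gamma_integrand (z + 1) t).
  rewrite !gamma_integrand_parts.
  replace (Re (z + 1) - 1)%R with x by (unfold x, Re; simpl; ring).
  replace (Im (z + 1)) with y by (unfold y, Im; simpl; ring).
  fold x y.
  assert (E : exp ((x - 1) * ln t) = (exp (x * ln t) / t)%R).
  { replace ((x - 1) * ln t)%R with (x * ln t + - ln t)%R by ring.
    rewrite exp_plus, exp_Ropp, exp_ln by exact Hpos. reflexivity. }
  rewrite E. unfold fr, fi.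
  apply injective_projections; simpl; change (fst z) with x; change (snd z) with y; field; lra.
Qed.

(** * Asymptotics of the gamma function *)

Lemma CGamma_1 : CGamma 1 = 1.
Proof.
  apply CGamma_unique.
  assert (H : is_RInt_gen (fun t => exp (- t)) zero_plus infty 1%R).
  { replace 1%R with (minus 0%R (- 1)%R) by (unfold minus, plus, opp; simpl; ring).
    apply (is_RInt_gen_primitive (V := R_CompleteNormedModule) (fun t => - exp (- t))%R).
    - intros a b _ _.
      apply (is_RInt_derive (V := R_CompleteNormedModule) (fun t => - exp (- t))%R); intros t _.
      + auto_derive; [exact I|]. ring.
      + apply (ex_derive_continuous (V := R_NormedModule)). auto_derive. exact I.
    - apply (filterlim_filter_le_1 (F := locally 0%R) (G := zero_plus));
        [exact (filter_le_within _)|].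
      replace (-1)%R with (- exp (- 0))%R by (rewrite Ropp_0, exp_0; reflexivity).
      apply (ex_derive_continuous (V := R_NormedModule) (fun t => - exp (- t))%R).
      auto_derive. exact I.
    - replace 0%R with (- 0)%R by ring.
      apply (filterlim_comp _ _ _ (fun t => exp (- t)) Ropp _ (locally 0%R)).
      + apply (filterlim_comp _ _ _ Ropp exp _ (Rbar_locally m_infty)); [|exact is_lim_exp_m].
        exact (filterlim_Rbar_opp p_infty).
      + exact (filterlim_opp (V := R_NormedModule) 0%R). }
  refine (is_RInt_gen_ext (V := C_R_NormedModule) _ _ _ _ (is_RInt_gen_RtoC _ _ H)).
  generalize positive_ends. apply filter_imp. intros [a b] [Ha Hb] t [Ht _]. simpl in *.
  unfold gamma_integrand. replace (1 - 1) with (RtoC (INR 0)) by (simpl; ring).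
  rewrite Rcpow_INR.
  - simpl. ring.
  - eapply Rlt_trans; [|exact Ht]; apply Rmin_glb_lt; assumption.
Qed.

Lemma CGamma_fact (k : nat) : CGamma (INR (S k)) = INR (fact k).
Proof.
  induction k as [|k IH].
  - simpl. apply CGamma_1.
  - rewrite (S_INR (S k)), RtoC_plus, CGamma_succ.
    + rewrite IH, fact_simpl, mult_INR, RtoC_mult. reflexivity.
    + rewrite re_RtoC. apply lt_0_INR. lia.
Qed.

Lemma CGamma_shift (z : C) (n : nat) : (0 < Re z)%R ->
  CGamma (z + INR n) = pochhammer z n * CGamma z.
Proof.
  intros Hz. induction n as [|n IH].
  - simpl. rewrite Cplus_0_r. ring.
  - rewrite RtoC_INR_S, Cplus_assoc, CGamma_succ.
    + rewrite IH. simpl. ring.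
    + rewrite Re_shift. pose proof (pos_INR n). lra.
Qed.

Lemma is_RInt_gen_Re (f : R -> C) (l : C) :
  is_RInt_gen (V := C_R_NormedModule) f zero_plus infty l ->
  is_RInt_gen (fun t => Re (f t)) zero_plus infty (Re l).
Proof.
  intros H P [eps HP].
  assert (HP' : locally (T := C_R_NormedModule) l (fun y => P (Re y))).
  { exists eps. intros y [Hy _]. apply HP. exact Hy. }
  specialize (H _ HP'). unfold filtermapi in *. revert H. apply filter_imp. intros [a b] [y [Hy Py]].
  exists (Re y). split; [|exact Py].
  exact (is_RInt_fct_extend_fst f a b y Hy).
Qed.

Lemma gamma_integrand_shift (z : C) (k : nat) (t : R) : (0 < t)%R ->
  gamma_integrand (z + INR (S k)) t = Rcpow t z * (t ^ k * exp (- t))%R.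
Proof.
  intros Ht. unfold gamma_integrand.
  replace (z + INR (S k) - 1) with (z + INR k) by (rewrite RtoC_INR_S; ring).
  rewrite Rcpow_plus, Rcpow_INR, RtoC_mult by exact Ht. ring.
Qed.

Lemma Rcpow_0 (t : R) : Rcpow t 0 = 1.
Proof. rewrite Rcpow_eq. simpl. rewrite !Rmult_0_l, exp_0, cos_0, sin_0, !Rmult_1_l. reflexivity. Qed.

Lemma gamma_integral (k : nat) : is_RInt_gen (fun t => t ^ k * exp (- t))%R zero_plus infty (INR (fact k)).
Proof.
  assert (Hk : (0 < Re (INR (S k)))%R) by (rewrite re_RtoC; apply lt_0_INR; lia).
  assert (H := is_RInt_gen_Re _ _ (CGamma_correct _ Hk)).
  rewrite CGamma_fact, re_RtoC in H.
  refine (is_RInt_gen_ext _ _ _ _ H).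
  generalize positive_ends. apply filter_imp. intros [a b] [Ha Hb] t [Ht _]. simpl fst in *. simpl snd in *.
  assert (Hpos : (0 < t)%R) by (eapply Rlt_trans; [|exact Ht]; apply Rmin_glb_lt; assumption).
  replace (RtoC (INR (S k))) with (0 + INR (S k)) by ring.
  rewrite gamma_integrand_shift, Rcpow_0, Cmult_1_l by exact Hpos. apply re_RtoC.
Qed.

(** The expectation of [g] at X / (k+1), where X has the gamma density
    t^k e^(-t) / k! of mean k+1.  A relation is used so that no integrability has
    to be proved separately. *)
Definition gamma_mean (k : nat) (g : R -> R) (v : R) : Prop :=
  is_RInt_gen (fun t => g (t / INR (S k)) * (t ^ k * exp (- t) / INR (fact k)))%R zero_plus infty v.

Definition gamma_moment (j k : nat) : R :=
  (INR (fact (k + j)) / (INR (fact k) * INR (S k) ^ j))%R.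

Lemma gamma_mean_ext (k : nat) (g h : R -> R) (v w : R) :
  (forall u, g u = h u) -> v = w -> gamma_mean k g v -> gamma_mean k h w.
Proof.
  intros E <- H. refine (is_RInt_gen_ext _ _ _ _ H).
  apply filter_forall. intros _ t _. now rewrite E.
Qed.

Lemma gamma_mean_plus (k : nat) (g h : R -> R) (v w : R) :
  gamma_mean k g v -> gamma_mean k h w -> gamma_mean k (fun u => g u + h u)%R (v + w).
Proof.
  intros Hg Hh. refine (is_RInt_gen_ext _ _ _ _ (is_RInt_gen_plus _ _ _ _ Hg Hh)).
  apply filter_forall. intros _ t _. unfold plus; simpl. ring.
Qed.

Lemma gamma_mean_scal (k : nat) (c : R) (g : R -> R) (v : R) :
  gamma_mean k g v -> gamma_mean k (fun u => c * g u)%R (c * v).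
Proof.
  intros Hg. refine (is_RInt_gen_ext _ _ _ _ (is_RInt_gen_scal _ c _ Hg)).
  apply filter_forall. intros _ t _. unfold scal; simpl; unfold mult; simpl. ring.
Qed.

Lemma gamma_mean_pow (k j : nat) : gamma_mean k (fun u => u ^ j)%R (gamma_moment j k).
Proof.
  assert (H := is_RInt_gen_scal _ (/ (INR (fact k) * INR (S k) ^ j))%R _ (gamma_integral (k + j))).
  unfold gamma_mean, gamma_moment.
  replace (INR (fact (k + j)) / (INR (fact k) * INR (S k) ^ j))%R
    with (scal (/ (INR (fact k) * INR (S k) ^ j))%R (INR (fact (k + j)) : R_NormedModule))
    by (unfold scal; simpl; unfold mult; simpl; apply Rmult_comm).
  refine (is_RInt_gen_ext _ _ _ _ H).
  apply filter_forall. intros _ t _. unfold scal; simpl scal; unfold mult.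
  change (/ (INR (fact k) * INR (S k) ^ j) * (t ^ (k + j) * exp (- t))
    = (t / INR (S k)) ^ j * (t ^ k * exp (- t) / INR (fact k)))%R.
  unfold Rdiv. rewrite pow_add, Rpow_mult_distr, pow_inv. 
  field. split; [apply INR_fact_neq_0 | apply pow_nonzero, not_0_INR; lia].
Qed.

Lemma gamma_moment_lim (j : nat) : is_lim_seq (gamma_moment j) 1.
Proof.
  induction j as [|j IH].
  - apply (is_lim_seq_ext (fun _ => 1%R)); [|apply is_lim_seq_const].
    intros n. unfold gamma_moment. rewrite Nat.add_0_r. simpl. field. apply INR_fact_neq_0.
  - apply (is_lim_seq_ext (fun k => gamma_moment j k * (1 + INR j * / INR (S k)))%R).
    + intros k. unfold gamma_moment. rewrite Nat.add_succ_r, fact_simpl, mult_INR.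
      rewrite (S_INR (k + j)), plus_INR, <- tech_pow_Rmult, (S_INR k).
      pose proof (pos_INR k). field.
      repeat split; [apply pow_nonzero; lra | lra | apply INR_fact_neq_0].
    + replace (Finite 1) with (Finite (1 * (1 + INR j * 0)))%R by (f_equal; ring).
      apply is_lim_seq_mult'; [exact IH|].
      apply is_lim_seq_plus'; [apply is_lim_seq_const|].
      apply is_lim_seq_mult'; [apply is_lim_seq_const | apply is_lim_seq_inv_S].
Qed.

Lemma exp_le_mono (r s : R) : (r <= s)%R -> (exp r <= exp s)%R.
Proof. intros [H| ->]; [left; apply exp_increasing, H | lra]. Qed.

Lemma Cmod_le_parts (a b : R) : (Cmod (a, b) <= Rabs a + Rabs b)%R.
Proof.
  replace ((a, b) : C) with (RtoC a + RtoC b * Ci).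
  - eapply Rle_trans; [apply Cmod_triangle|].
    rewrite Cmod_mult, !Cmod_R, Cmod_Ci. lra.
  - apply injective_projections; simpl; ring.
Qed.

(** The mean value theorem applied to the real and imaginary parts; the assumption
    on Re z keeps the derivative bounded near 0. *)
Lemma Rcpow_lipschitz (z : C) : (1 <= Re z)%R ->
  exists (K : R) (N : nat), (0 <= K)%R /\ forall u, (0 < u)%R ->
    (Cmod (Rcpow u z - 1) <= K * (Rabs (u - 1) * (1 + u ^ N)))%R.
Proof.
  intros Hz. set (x := Re z) in *. set (y := Im z).
  destruct (eventually_INR_ge (x - 1)) as [N HN]. specialize (HN N (Nat.le_refl N)).
  set (L := (Rabs x + Rabs y)%R).
  assert (HL : (0 <= L)%R) by (unfold L; pose proof (Rabs_pos x); pose proof (Rabs_pos y); lra).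
  exists (2 * L)%R, N. split; [lra|]. intros u Hu.
  assert (Hmin : (0 < Rmin 1 u)%R) by (apply Rmin_glb_lt; lra).
  assert (HB : forall s, (Rmin 1 u <= s <= Rmax 1 u -> exp (x * ln s) / s <= 1 + u ^ N)%R).
  { intros s [Hs1 Hs2]. assert (Hs : (0 < s)%R) by lra.
    replace (exp (x * ln s) / s)%R with (exp ((x - 1) * ln s)).
    2:{ replace ((x - 1) * ln s)%R with (x * ln s + - ln s)%R by ring.
        rewrite exp_plus, exp_Ropp, exp_ln by exact Hs. reflexivity. }
    assert (HuN : (0 < u ^ N)%R) by (apply pow_lt, Hu).
    destruct (Rle_lt_dec s 1) as [H1|H1].
    - assert (Hl : (ln s <= 0)%R) by (rewrite <- ln_1; apply ln_le; lra).
      assert (exp ((x - 1) * ln s) <= 1)%R; [|lra].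
      apply Rle_trans with (exp 0); [apply exp_le_mono; nra | rewrite exp_0; lra].
    - assert (Hsu : (s <= u)%R).
      { unfold Rmax in Hs2. destruct (Rle_dec 1 u); lra. }
      assert (Hl : (0 <= ln s)%R) by (rewrite <- ln_1; apply ln_le; lra).
      assert (Hlu : (ln s <= ln u)%R) by (apply ln_le; lra).
      assert (exp ((x - 1) * ln s) <= u ^ N)%R; [|lra].
      rewrite <- (Rpower_pow N u) by exact Hu. unfold Rpower.
      apply exp_le_mono, Rmult_le_compat; lra. }
  assert (HMVT : forall (F : R -> R) (F' : R -> R),
    (forall s, 0 < s -> is_derive F s (F' s))%R ->
    (forall s, 0 < s -> Rabs (F' s) <= L * (exp (x * ln s) / s))%R ->
    (Rabs (F u - F 1) <= L * (Rabs (u - 1) * (1 + u ^ N)))%R).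
  { intros F F' HF HF'.
    destruct (MVT_gen F 1 u F') as [s [Hs E]].
    - intros s Hs. apply HF. lra.
    - intros s Hs. apply continuity_pt_filterlim, (ex_derive_continuous (V := R_NormedModule)).
      exists (F' s). apply HF. lra.
    - rewrite E, Rabs_mult.
      specialize (HF' s ltac:(lra)). specialize (HB s Hs).
      apply Rle_trans with (L * (1 + u ^ N) * Rabs (u - 1))%R; [|lra].
      apply Rmult_le_compat_r; [apply Rabs_pos|].
      eapply Rle_trans; [exact HF'|]. apply Rmult_le_compat_l; assumption. }
  assert (Htrig : forall (p q th : R), (Rabs (p * cos th + q * sin th) <= Rabs p + Rabs q)%R).
  { intros p q th. eapply Rle_trans; [apply Rabs_triang|]. rewrite !Rabs_mult.
    assert (Rabs (cos th) <= 1)%R by (apply Rabs_le, COS_bound).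
    assert (Rabs (sin th) <= 1)%R by (apply Rabs_le, SIN_bound).
    pose proof (Rabs_pos p). pose proof (Rabs_pos q). nra. }
  assert (H1 := HMVT (fun s => exp (x * ln s) * cos (y * ln s))%R
    (fun s => exp (x * ln s) / s * (x * cos (y * ln s) + - y * sin (y * ln s)))%R).
  assert (H2 := HMVT (fun s => exp (x * ln s) * sin (y * ln s))%R
    (fun s => exp (x * ln s) / s * (y * cos (y * ln s) + x * sin (y * ln s)))%R).
  cbv beta in H1, H2. rewrite ln_1, !Rmult_0_r, exp_0, cos_0, Rmult_1_l in H1.
  rewrite ln_1, !Rmult_0_r, exp_0, sin_0, Rmult_1_l in H2.
  replace (Rcpow u z - 1) with
    ((exp (x * ln u) * cos (y * ln u) - 1, exp (x * ln u) * sin (y * ln u) - 0)%R : C).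
  2:{ rewrite Rcpow_eq. apply injective_projections; simpl; reflexivity. }
  eapply Rle_trans; [apply Cmod_le_parts|].
  assert (Hp : forall s, (0 < s -> 0 < exp (x * ln s) / s)%R).
  { intros s Hs. apply Rdiv_lt_0_compat; [apply exp_pos | exact Hs]. }
  apply Rle_trans with (L * (Rabs (u - 1) * (1 + u ^ N)) + L * (Rabs (u - 1) * (1 + u ^ N)))%R; [|lra].
  apply Rplus_le_compat; [apply H1 | apply H2]; intros s Hs.
  1,3: auto_derive; [repeat split; exact Hs | field; lra].
  - rewrite Rabs_mult, Rabs_pos_eq by (left; apply Hp, Hs). rewrite Rmult_comm.
    apply Rmult_le_compat_r; [left; apply Hp, Hs|]. unfold L.
    rewrite <- (Rabs_Ropp y). apply Htrig.
  - rewrite Rabs_mult, Rabs_pos_eq by (left; apply Hp, Hs). rewrite Rmult_comm.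
    apply Rmult_le_compat_r; [left; apply Hp, Hs|]. unfold L.
    rewrite (Rplus_comm (Rabs x)). apply Htrig.
Qed.

(** The expectation of the polynomial in [deviation_mean_correct], written out in
    moments.  That polynomial bounds |u - 1| (1 + u^N), because
    |u - 1| <= eps + (u - 1)^2 / eps. *)
Definition deviation_mean (eps : R) (N k : nat) : R :=
  ((eps + / eps) * gamma_moment 0 k + (-2 * / eps) * gamma_moment 1 k + / eps * gamma_moment 2 k
   + ((eps + / eps) * gamma_moment N k + (-2 * / eps) * gamma_moment (S N) k
      + / eps * gamma_moment (S (S N)) k))%R.

Lemma deviation_mean_lim (eps : R) (N : nat) : is_lim_seq (deviation_mean eps N) (2 * eps)%R.
Proof.
  replace (Finite (2 * eps)) with (Finite
    ((eps + / eps) * 1 + (-2 * / eps) * 1 + / eps * 1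
      + ((eps + / eps) * 1 + (-2 * / eps) * 1 + / eps * 1))%R) by (f_equal; ring).
  unfold deviation_mean.
  repeat apply is_lim_seq_plus'; apply is_lim_seq_mult';
    try apply is_lim_seq_const; apply gamma_moment_lim.
Qed.

Lemma deviation_mean_correct (eps : R) (N k : nat) : (0 < eps)%R ->
  gamma_mean k (fun u => (eps + (u - 1) ^ 2 / eps) * (1 + u ^ N))%R (deviation_mean eps N k).
Proof.
  intros He.
  apply (gamma_mean_ext k (fun u =>
    (eps + / eps) * u ^ 0 + (-2 * / eps) * u ^ 1 + / eps * u ^ 2
     + ((eps + / eps) * u ^ N + (-2 * / eps) * u ^ (S N) + / eps * u ^ (S (S N))))%R
    _ (deviation_mean eps N k)); [|reflexivity|].
  - intros u. simpl. field. lra.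
  - unfold deviation_mean.
    assert (M := fun c j => gamma_mean_scal k c _ _ (gamma_mean_pow k j)).
    pose proof (gamma_mean_plus k _ _ _ _
      (gamma_mean_plus k _ _ _ _ (gamma_mean_plus k _ _ _ _ (M (eps + / eps)%R 0%nat)
        (M (-2 * / eps)%R 1%nat)) (M (/ eps)%R 2%nat))
      (gamma_mean_plus k _ _ _ _ (gamma_mean_plus k _ _ _ _ (M (eps + / eps)%R N)
        (M (-2 * / eps)%R (S N))) (M (/ eps)%R (S (S N))))) as H.
    exact H.
Qed.

(** Divided by m^z (m-1)!, where m = k+1, the integral for Gamma(z + m) is the
    expectation of u^z for u = X / m. *)
Lemma CGamma_ratio_le (z : C) (K : R) (N k : nat) (eps : R) :
  (1 <= Re z)%R -> (0 < eps)%R -> (0 <= K)%R ->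
  (forall u, 0 < u -> Cmod (Rcpow u z - 1) <= K * (Rabs (u - 1) * (1 + u ^ N)))%R ->
  (Cmod (CGamma (z + INR (S k)) / (Rcpow (INR (S k)) z * INR (fact k)) - 1)
    <= K * deviation_mean eps N k)%R.
Proof.
  intros Hz He HK0 HK.
  assert (HM : (0 < INR (S k))%R) by (apply lt_0_INR; lia).
  assert (HP := Rcpow_neq_0 (INR (S k)) z).
  assert (HF : RtoC (INR (fact k)) <> 0) by apply INR_C_neq_0, lt_O_fact.
  set (A := / (Rcpow (INR (S k)) z * INR (fact k))). set (B := / RtoC (INR (fact k))).
  assert (H1 : is_RInt_gen (V := C_R_NormedModule)
    (fun t => A * gamma_integrand (z + INR (S k)) t) zero_plus infty (A * CGamma (z + INR (S k)))).
  { apply is_RInt_gen_Cscal, CGamma_correct. rewrite Re_shift. lra. }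
  assert (H2 : is_RInt_gen (V := C_R_NormedModule)
    (fun t => B * gamma_integrand (INR (S k)) t) zero_plus infty (B * CGamma (INR (S k)))).
  { apply is_RInt_gen_Cscal, CGamma_correct. rewrite re_RtoC. exact HM. }
  assert (H := is_RInt_gen_minus _ _ _ _ H1 H2).
  assert (HG := gamma_mean_scal k K _ _ (deviation_mean_correct eps N k He)).
  assert (HN := fun Hle => RInt_gen_norm (V := C_R_CompleteNormedModule) _ _ _ _
    (filter_imp _ _ (fun ab Hab => proj2 Hab) ordered_ends) Hle H HG).
  rewrite <- Cmod_norm in HN.
  replace (CGamma (z + INR (S k)) / (Rcpow (INR (S k)) z * INR (fact k)) - 1)
    with (minus (G := C_R_NormedModule) (A * CGamma (z + INR (S k))) (B * CGamma (INR (S k)))).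
  2:{ change (A * CGamma (z + INR (S k)) - B * CGamma (INR (S k)) =
        CGamma (z + INR (S k)) / (Rcpow (INR (S k)) z * INR (fact k)) - 1).
      rewrite CGamma_fact. unfold A, B. field. split; assumption. }
  apply HN. clear HN H HG H1 H2.
  generalize ordered_ends. apply filter_imp. intros [a b] [Ha Hab] t [Ht _]. simpl fst in *. simpl snd in *.
  assert (Hpos : (0 < t)%R) by lra.
  rewrite <- Cmod_norm.
  set (u := (t / INR (S k))%R). assert (Hu : (0 < u)%R) by (apply Rdiv_lt_0_compat; assumption).
  set (W := (t ^ k * exp (- t))%R).
  assert (HW : (0 <= W)%R).
  { apply Rmult_le_pos; [apply pow_le; lra | apply Rlt_le, exp_pos]. }
  assert (HFr := INR_fact_lt_0 k).
  replace (minus (G := C_R_NormedModule) (A * gamma_integrand (z + INR (S k)) t) (B * gamma_integrand (INR (S k)) t))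
    with ((Rcpow u z - 1) * (W / INR (fact k))%R).
  2:{ change ((Rcpow u z - 1) * (W / INR (fact k))%R
        = A * gamma_integrand (z + INR (S k)) t - B * gamma_integrand (INR (S k)) t).
      replace (RtoC (INR (S k))) with (0 + INR (S k)) at 2 by ring.
      rewrite !gamma_integrand_shift, Rcpow_0 by exact Hpos. fold W.
      replace (Rcpow t z) with (Rcpow (INR (S k)) z * Rcpow u z).
      2:{ rewrite <- Rcpow_mult_base by assumption. f_equal. unfold u. field. lra. }
      rewrite RtoC_div by lra. unfold A, B. field. split; assumption. }
  rewrite Cmod_mult, Cmod_R, (Rabs_pos_eq (W / _)) by (apply Rmult_le_pos; [lra | left; apply Rinv_0_lt_compat; lra]).
  apply Rmult_le_compat_r; [apply Rmult_le_pos; [lra | left; apply Rinv_0_lt_compat; lra]|].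
  eapply Rle_trans; [apply HK, Hu|]. apply Rmult_le_compat_l; [exact HK0|].
  apply Rmult_le_compat_r; [pose proof (pow_lt u N Hu); lra|].
  set (v := (u - 1)%R). rewrite <- pow2_abs.
  set (s := Rabs v). pose proof (Rabs_pos v) as Hs. fold s in Hs.
  assert (E : (eps * (eps + s ^ 2 / eps) = eps ^ 2 + s ^ 2)%R) by (field; lra).
  apply (Rmult_le_reg_l eps); [exact He|]. rewrite E. nra.
Qed.

(** All moments of X / m tend to 1, so the bound of [CGamma_ratio_le] tends to
    2 K eps, and eps is arbitrary. *)
Lemma CGamma_asymptotic (z : C) : (1 <= Re z)%R ->
  Ctends (fun k => CGamma (z + INR (S k)) / (Rcpow (INR (S k)) z * INR (fact k))) 1.
Proof.
  intros Hz. destruct (Rcpow_lipschitz z Hz) as [K [N [HK0 HK]]].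
  apply Ctends_eps. intros eps.
  set (e := (eps / (2 * (K + 1)))%R).
  assert (Hep := cond_pos eps).
  assert (He : (0 < e)%R) by (apply Rdiv_lt_0_compat; lra).
  assert (Hl : is_lim_seq (fun k => K * deviation_mean e N k)%R (K * (2 * e))%R).
  { apply is_lim_seq_mult'; [apply is_lim_seq_const | apply deviation_mean_lim]. }
  assert (Hlt : (0 < eps - K * (2 * e))%R).
  { replace (eps - K * (2 * e))%R with (eps / (K + 1))%R by (unfold e; field; lra).
    apply Rdiv_lt_0_compat; lra. }
  apply is_lim_seq_spec in Hl. specialize (Hl (mkposreal _ Hlt)).
  revert Hl. apply filter_imp. intros k Hk. simpl in Hk. apply Rabs_def2 in Hk.
  eapply Rle_lt_trans; [apply (CGamma_ratio_le z K N k e); assumption|]. lra.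
Qed.

(** A zero would propagate to all z + n by the functional equation, against the
    asymptotics. *)
Lemma CGamma_neq_0 (z : C) : (0 < Re z)%R -> CGamma z <> 0.
Proof.
  intros Hz E.
  assert (H1 : (1 <= Re (z + 1))%R) by (unfold Re in *; simpl; lra).
  assert (H := CGamma_asymptotic (z + 1) H1).
  assert (H0 : RtoC 1 = RtoC 0).
  { apply (Ctends_unique _ _ _ H). apply (Ctends_ext (fun _ => RtoC 0)); [|apply Ctends_const].
    intros k. replace (z + 1 + INR (S k)) with (z + INR (S (S k)))
      by (rewrite (RtoC_INR_S (S k)); ring).
    rewrite CGamma_shift, E by exact Hz. unfold Cdiv. ring. }
  apply RtoC_inj in H0. lra.
Qed.

(** * Gauss's summation theorem *)

(** With S_p the sum of the series with third parameter c + p, the ratio of S_p to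
    the gamma quotient for c + p does not depend on [p], by [gauss_contiguous] and
    the functional equation; it tends to 1, because the powers of m in the four
    asymptotic formulas cancel.  The argument is shifted once more inside [lam]
    since the asymptotics are available for real part at least 1. *)
Lemma gauss_summation (a b c G : C) :
  (0 < Re c)%R -> (0 < Re (c - a))%R -> (0 < Re (c - b))%R -> (0 < Re (c - a - b))%R ->
  is_series (hyper a b c) G ->
  G = CGamma c * CGamma (c - a - b) / (CGamma (c - a) * CGamma (c - b)).
Proof.
  intros Hc Ha Hb Hab HG.
  set (Gs := fun p => Cseries_sum (hyper a b (c + INR p))).
  assert (Hre : forall (x : C) p, (0 < Re x)%R -> (0 < Re (x + INR p))%R).
  { intros x p Hx. rewrite Re_shift. pose proof (pos_INR p). lra. }
  assert (Hsh : forall p, c + INR p - a - b = c - a - b + INR p) by (intros; ring).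
  assert (HGs : forall p, is_series (hyper a b (c + INR p)) (Gs p)).
  { intros p. apply Cseries_sum_correct, hyper_abs_series; [apply Hre, Hc|].
    rewrite Hsh. apply Hre, Hab. }
  assert (HG0 : Gs O = G).
  { apply (Ctends_unique (sum_n (hyper a b c))); apply is_series_Ctends; [|exact HG].
    specialize (HGs O). simpl in HGs. rewrite Cplus_0_r in HGs. exact HGs. }
  set (P := G * CGamma (c - a) * CGamma (c - b)).
  set (Q := CGamma c * CGamma (c - a - b)).
  assert (HPQ : forall p, Gs p * CGamma (c - a + INR p) * CGamma (c - b + INR p) * Q
    = P * (CGamma (c + INR p) * CGamma (c - a - b + INR p))).
  { induction p as [|p IH].
    - simpl INR. rewrite !Cplus_0_r, HG0. unfold P, Q. ring.
    - rewrite !RtoC_INR_S, !Cplus_assoc, !CGamma_succ by (apply Hre; assumption).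
      assert (E := gauss_contiguous a b (c + INR p) (Gs p) (Gs (S p)) (Hre _ _ Hc)).
      rewrite Hsh in E. specialize (E (Hre _ _ Hab) (HGs p)).
      replace (c + INR p + 1) with (c + INR (S p)) in E by (rewrite RtoC_INR_S; ring).
      specialize (E (HGs (S p))).
      transitivity ((c + INR p - a) * (c + INR p - b) * Gs (S p)
        * (CGamma (c - a + INR p) * CGamma (c - b + INR p) * Q)); [ring|].
      rewrite <- E.
      transitivity ((c + INR p) * (c - a - b + INR p)
        * (Gs p * CGamma (c - a + INR p) * CGamma (c - b + INR p) * Q)); [ring|].
      rewrite IH. ring. }
  set (lam := fun (x : C) k => CGamma (x + 1 + INR (S k)) / (Rcpow (INR (S k)) (x + 1) * INR (fact k))).
  assert (Hlam : forall x, (0 < Re x)%R -> Ctends (lam x) 1).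
  { intros x Hx. apply CGamma_asymptotic. unfold Re in *; simpl; lra. }
  assert (HL : Ctends (fun k => Gs (S (S k)) * lam (c - a) k * lam (c - b) k * Q) (1 * 1 * 1 * Q)).
  { apply Ctends_mult; [|apply Ctends_const].
    apply Ctends_mult; [|apply Hlam, Hb].
    apply Ctends_mult; [|apply Hlam, Ha].
    assert (Hg := gauss_sum_limit a b c Gs Hc Hab HGs).
    unfold Ctends in *.
    apply -> (is_lim_seq_incr_1 (fun k => Cmod (Gs k - 1))) in Hg.
    apply -> (is_lim_seq_incr_1 (fun k => Cmod (Gs (S k) - 1))) in Hg. exact Hg. }
  assert (HR : Ctends (fun k => P * (lam c k * lam (c - a - b) k)) (P * (1 * 1))).
  { apply Ctends_mult; [apply Ctends_const|]. apply Ctends_mult; apply Hlam; assumption. }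
  assert (E : 1 * 1 * 1 * Q = P * (1 * 1)).
  { apply (Ctends_unique _ _ _ HL). refine (Ctends_ext _ _ _ _ HR).
    intros k. unfold lam.
    assert (E2 : forall x : C, x + 1 + INR (S k) = x + INR (S (S k))).
    { intros x. rewrite (RtoC_INR_S (S k)). ring. }
    rewrite !E2. specialize (HPQ (S (S k))).
    set (M := INR (S k)) in *.
    assert (HFk : RtoC (INR (fact k)) <> 0) by apply INR_C_neq_0, lt_O_fact.
    assert (Hpow : Rcpow M (c + 1) * Rcpow M (c - a - b + 1)
      = Rcpow M (c - a + 1) * Rcpow M (c - b + 1)).
    { rewrite <- !Rcpow_plus. f_equal. ring. }
    assert (R1 := Rcpow_neq_0 M (c + 1)). assert (R2 := Rcpow_neq_0 M (c - a - b + 1)).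
    assert (R3 := Rcpow_neq_0 M (c - a + 1)). assert (R4 := Rcpow_neq_0 M (c - b + 1)).
    transitivity (P * (CGamma (c + INR (S (S k))) * CGamma (c - a - b + INR (S (S k))))
      / (Rcpow M (c + 1) * Rcpow M (c - a - b + 1) * (INR (fact k) * INR (fact k)))).
    - field. repeat split; assumption.
    - rewrite <- HPQ, Hpow. field. repeat split; assumption. }
  assert (N1 := CGamma_neq_0 _ Ha). assert (N2 := CGamma_neq_0 _ Hb).
  fold Q. replace Q with P.
  - unfold P. field. split; assumption.
  - transitivity (P * (1 * 1)); [ring|]. rewrite <- E. ring.
Qed.

Theorem theorem5 (b : C) (hb : (1 / 2 < Re b)%R) :
  let u (n : nat) : C :=
    pochhammer (1 / 2) n * pochhammer b n
      / (INR (fact n) * pochhammer (2 * b) n) * harmonic n in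
  let v (n : nat) : C :=
    pochhammer (1 / 2) n * pochhammer (1 - b) n
      / (INR (fact n) * pochhammer (b + 1 / 2) n) * harmonic (2 * n) in
  exists U V : C,
    is_series (fun k : nat => u (S k)) U /\
    is_series (fun k : nat => v (S k)) V /\
    1 / 4 * U =
      V + CGamma (b + 1 / 2) * CGamma (2 * b - 1)
            / (CGamma b * CGamma (2 * b - 1 / 2)) * ln 2.
Proof.
  intros u v.
  destruct (transformed_params_pos b hb) as [Hc Hs].
  set (G := Cseries_sum (transformed b)).
  assert (HG : is_series (transformed b) G).
  { apply Cseries_sum_correct, hyper_abs_series; assumption. }
  assert (HV : is_series v (Cseries_sum v)).
  { apply Cseries_sum_correct. refine (ex_series_ext _ _ _ (transformed_harmonic_ex_series b hb)).
    intros n. unfold v. rewrite Cmod_mult, Cmod_R, Rabs_pos_eq by apply harmonic_ge_0.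
    reflexivity. }
  assert (HU := harmonic_transform b G (Cseries_sum v) hb HG HV).
  assert (Hshift : forall (a : nat -> C) (l : C), a O = 0 -> is_series a l ->
    is_series (fun k => a (S k)) l).
  { intros a l Ha Hl. apply (is_series_incr_1 a l). rewrite Ha.
    replace (plus l _) with l; [exact Hl|].
    symmetry. exact (Cplus_0_r l). }
  exists (4 * Cseries_sum v + 4 * ln 2 * G), (Cseries_sum v). repeat split.
  - apply (Hshift u); [|exact HU]. unfold u. rewrite harmonic_0. ring.
  - apply (Hshift v); [|exact HV]. unfold v. simpl Nat.mul. rewrite harmonic_0. ring.
  - assert (EG := gauss_summation (1 / 2) (1 - b) (b + 1 / 2) G Hc).
    replace (b + 1 / 2 - 1 / 2 - (1 - b)) with (2 * b - 1) in * by field.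
    replace (b + 1 / 2 - 1 / 2) with b in EG by field.
    replace (b + 1 / 2 - (1 - b)) with (2 * b - 1 / 2) in EG by field.
    rewrite <- EG; [field | | | exact Hs | exact HG].
    + lra.
    + unfold Re in *; simpl; lra.
Qed.
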